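(* Let $\Lambda$ and $\Gamma$ be finite graphs such that $\Lambda$ is a forest. Then $A(\Lambda)$ embeds into $A(\Gamma)$ if and only if $\Lambda$ is isomorphic to an induced subgraph of the extension graph $\Gamma^e$.
   Context: A graph is a (possibly infinite) simplicial 1-complex (no loops, no multi-edges). For a graph $\Gamma$ with vertex set $V(\Gamma)$ and edge set $E(\Gamma)$, the right-angled Artin group is $A(\Gamma)=\langle V(\Gamma)\mid [v,v']=1 \text{ for each } \{v,v'\}\in E(\Gamma)\rangle$. The extension graph $\Gamma^e$ is the graph whose vertices are the elements of $A(\Gamma)$ that are conjugate to vertices of $\Gamma$ (viewed as generators), two distinct vertices being adjacent if and only if they commute in $A(\Gamma)$. A forest is a disjoint union of trees. A group $H$ embeds into $G$ if there is an injective homomorphism $H\to G$. *)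

(* Defs.v *)
From HB Require Import structures.
From mathcomp Require Import all_boot.
From mathcomp Require Import boolp classical_sets cardinality.

Set Implicit Arguments.
Unset Strict Implicit.
Unset Printing Implicit Defensive.

Import Algebra.

Local Open Scope group_scope.
Local Open Scope quotient_scope.

(* Graphs may be infinite. Asking for a choiceType of vertices and a boolean
   adjacency is no restriction, as the setting is classical. *)
Record graph := Graph {
  vertex :> choiceType;
  adj : rel vertex;
  adj_sym : symmetric adj;
  adj_irr : irreflexive adj }.
Arguments adj {_} _ _.

Definition finite_graph (G : graph) : Prop := finite_set [set: G].

Definition graph_iso (G H : graph) : Prop :=
  exists2 f : G -> H, bijective f & {mono f : x y / adj x y}.

Section InducedSubgraph.
Context (G : graph) (A : pred G).

Let induced_adj : rel {x : G | A x} := fun x y => adj (val x) (val y).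

Fact induced_sym : symmetric induced_adj.
Proof. by move=> x y; apply: adj_sym. Qed.

Fact induced_irr : irreflexive induced_adj.
Proof. by move=> x; apply: adj_irr. Qed.

Definition induced := Graph induced_sym induced_irr.
End InducedSubgraph.

Definition connected_graph (G : graph) : Prop :=
  forall x y : G, exists2 p : seq G, path adj x p & last x p = y.

(* The length condition excludes the degenerate closed walks x, y, x along
   a single edge, which [ucycle] accepts. *)
Definition acyclic_graph (G : graph) : Prop :=
  forall c : seq G, 2 < size c -> ~ ucycle adj c.

Definition tree (G : graph) : Prop :=
  [/\ inhabited G, connected_graph G & acyclic_graph G].

Section DisjointUnion.
Context (I : choiceType) (T : I -> graph).

Let disjoint_union_adj : rel {i : I & T i} := fun x y =>
  (tag x == tag y) && adj (tagged x) (tagged_as x y).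

Fact disjoint_union_sym : symmetric disjoint_union_adj.
Proof.
move=> [i x] [j y]; rewrite /disjoint_union_adj /= eq_sym.
by case: eqVneq y => //= -> y; rewrite !tagged_asE adj_sym.
Qed.

Fact disjoint_union_irr : irreflexive disjoint_union_adj.
Proof.
by move=> [i x]; rewrite /disjoint_union_adj /= eqxx tagged_asE adj_irr.
Qed.

Definition disjoint_union := Graph disjoint_union_sym disjoint_union_irr.
End DisjointUnion.

Definition forest (G : graph) : Prop :=
  exists (I : choiceType) (T : I -> graph),
    (forall i, tree (T i)) /\ graph_iso G (disjoint_union T).

(* Presented groups are words modulo the least congruence that kills
   [l; l^-1] for each letter l and each relator. The letter (v, false)
   stands for the generator v and (v, true) for its formal inverse. *)
Definition word (V : Type) := seq (V * bool).

Definition letter_inv (V : Type) (l : V * bool) : V * bool := (l.1, ~~ l.2).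

Definition word_inv (V : Type) (w : word V) : word V :=
  rev (map (@letter_inv V) w).

Inductive pres_eq (V : Type) (R : word V -> Prop) : word V -> word V -> Prop :=
| pres_refl w : pres_eq R w w
| pres_sym w1 w2 : pres_eq R w1 w2 -> pres_eq R w2 w1
| pres_trans w1 w2 w3 : pres_eq R w1 w2 -> pres_eq R w2 w3 -> pres_eq R w1 w3
| pres_cat u1 u2 w1 w2 :
    pres_eq R u1 u2 -> pres_eq R w1 w2 -> pres_eq R (u1 ++ w1) (u2 ++ w2)
| pres_cancel l : pres_eq R [:: l; letter_inv l] [::]
| pres_relator w : R w -> pres_eq R w [::].

Section Presented.
Context (V : choiceType) (R : word V -> Prop).

Definition pres_eqb : rel (word V) := fun u w => `[< pres_eq R u w >].

Fact pres_eqb_refl : reflexive pres_eqb.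
Proof. by move=> w; apply/asboolP/pres_refl. Qed.

Fact pres_eqb_sym : symmetric pres_eqb.
Proof. by move=> u w; apply/asboolP/asboolP => /pres_sym. Qed.

Fact pres_eqb_trans : transitive pres_eqb.
Proof.
move=> w u x /asboolP uw /asboolP wx.
exact/asboolP/(pres_trans uw wx).
Qed.

Canonical pres_eqb_equiv :=
  EquivRel pres_eqb pres_eqb_refl pres_eqb_sym pres_eqb_trans.

Definition presented := {eq_quot pres_eqb}.
HB.instance Definition _ := EqQuotient.on presented.
HB.instance Definition _ := Choice.on presented.

Lemma presentedP (u w : word V) :
  \pi_presented u = \pi_presented w <-> pres_eq R u w.
Proof. by split=> [/eqmodP/asboolP|uw]; last exact/eqmodP/asboolP. Qed.

Lemma pres_eq_repr (w : word V) : pres_eq R (repr (\pi_presented w)) w.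
Proof. by apply/presentedP; rewrite reprK. Qed.

Lemma pres_word_invl (w : word V) : pres_eq R (word_inv w ++ w) [::].
Proof.
elim: w => [|l w IHw]; first exact: pres_refl.
rewrite /word_inv /= rev_cons -cats1 -catA /=.
apply: pres_trans IHw.
rewrite -[w in X in pres_eq _ _ X]cat0s -(cat1s _ (l :: w)) -(cat1s l w).
apply: pres_cat (pres_refl _ _) _; rewrite catA.
apply: pres_cat (pres_refl _ _).
by case: l => v b; have := pres_cancel R (v, ~~ b); rewrite /letter_inv /= negbK.
Qed.

Lemma word_invK : involutive (@word_inv V).
Proof.
move=> w; rewrite /word_inv map_rev revK -map_comp map_id_in // => -[v b] _.
by rewrite /letter_inv /= negbK.
Qed.

Lemma pres_word_invr (w : word V) : pres_eq R (w ++ word_inv w) [::].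
Proof. by rewrite -{1}(word_invK w); apply: pres_word_invl. Qed.

Definition pres_one : presented := \pi_presented [::].
Definition pres_mul (x y : presented) : presented := \pi_presented (repr x ++ repr y).
Definition pres_inv (x : presented) : presented := \pi_presented (word_inv (repr x)).

Fact pres_mulA : associative pres_mul.
Proof.
move=> x y z; apply/presentedP.
apply: (pres_trans (pres_cat (pres_refl _ _) (pres_eq_repr _))).
rewrite catA; apply/pres_sym.
exact: pres_cat (pres_eq_repr _) (pres_refl _ _).
Qed.

Fact pres_mul1g : left_id pres_one pres_mul.
Proof.
move=> x; rewrite -[RHS]reprK; apply/presentedP.
exact: pres_cat (pres_eq_repr _) (pres_refl _ _).
Qed.

Fact pres_mulg1 : right_id pres_one pres_mul.
Proof.
move=> x; rewrite -[RHS]reprK; apply/presentedP.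
rewrite -[X in pres_eq _ _ X]cats0.
exact: pres_cat (pres_refl _ _) (pres_eq_repr _).
Qed.

Fact pres_mulVg : left_inverse pres_one pres_inv pres_mul.
Proof.
move=> x; apply/presentedP; apply: pres_trans (pres_word_invl (repr x)).
exact: pres_cat (pres_eq_repr _) (pres_refl _ _).
Qed.

Fact pres_mulgV : right_inverse pres_one pres_inv pres_mul.
Proof.
move=> x; apply/presentedP; apply: pres_trans (pres_word_invr (repr x)).
exact: pres_cat (pres_refl _ _) (pres_eq_repr _).
Qed.

HB.instance Definition _ := isGroup.Build presented
  pres_mulA pres_mul1g pres_mulg1 pres_mulVg pres_mulgV.

Definition pres_gen (v : V) : presented := \pi_presented [:: (v, false)].
End Presented.

Definition raag_relator (G : graph) (w : word G) : Prop :=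
  exists v v' : G, adj v v' /\
    w = [:: (v, true); (v', true); (v, false); (v', false)].

Definition raag (G : graph) : groupType := presented (@raag_relator G).

Definition raag_gen (G : graph) (v : G) : raag G := pres_gen _ v.

Section ExtensionGraph.
Context (G : graph).

Definition ext_vertex : pred (raag G) := fun g =>
  `[< exists (v : G) (x : raag G), g = raag_gen v ^ x >].

Let ext_adj : rel {g : raag G | ext_vertex g} := fun g h =>
  (val g != val h) && `[< commute (val g) (val h) >].

Fact ext_sym : symmetric ext_adj.
Proof.
by move=> g h; rewrite /ext_adj eq_sym; congr (_ && _); apply/asboolP/asboolP.
Qed.

Fact ext_irr : irreflexive ext_adj.
Proof. by move=> g; rewrite /ext_adj eqxx. Qed.

Definition ext_graph := Graph ext_sym ext_irr.
End ExtensionGraph.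

(* A UMagmaMorphism between groups is a group homomorphism. *)
Definition embeds (H G : groupType) : Prop :=
  exists f : UMagmaMorphism.type H G, injective f.

(* Main.v *)
Require Import Defs.
From mathcomp Require Import all_boot.
From HB Require Import structures.
From mathcomp Require Import boolp classical_sets cardinality.
From mathcomp Require Import ssralg ssrint ring zify.

(* Idea. Conjugating by powers of a vertex v, the copies u^(v^i) generate the
   RAAG of the graph obtained by gluing infinitely many copies of the graph
   along the link of v. Iterating this, the path P4 yields all finite forests,
   and each of P2 + P1, P3, P3 + P1, 2 P1 yields the corresponding star forests,
   always with generators sent to conjugates of generators; such an embedding
   gives both A(L) <= A(G) and L <= G^e. If G does not contain P4, it is a
   cograph. If moreover L contains one of the small graphs Q and G does not,
   then induction along disjoint unions (free products) and joins (direct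
   products) shows that A(G) satisfies a relation violated in A(Q) and that
   G^e does not contain Q, so that neither side of the equivalence holds. *)

Set Implicit Arguments.
Unset Strict Implicit.
Unset Printing Implicit Defensive.

Import Algebra.

Local Open Scope group_scope.
Local Open Scope quotient_scope.

(** * Universal property *)

(** What makes the induction run on free products is the shape of centralizers: a nontrivial element
    is either conjugate into a factor, and then the same conjugator carries its whole centralizer
    there, or its centralizer is abelian. For [P3 + P1] and [P2 + P1] there is a second reason: at a
    disjoint union each part supplies an isolated vertex for the other, so neither part contains
    [P3], respectively an edge. Commutation is then transitive on nontrivial elements, respectively
    the group is free. On direct products relations are checked coordinatewise. The graph [P2 + P1]
    gets no fixed law: commuting elements of a free group have a common power, but the exponents
    depend on the elements. The relation is therefore a family of iterated commutators, and its
    failure has to be shown for every choice of exponents at once. No solution of the word problem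
    in a RAAG is developed: injectivity and nontriviality are read off from retractions and explicit
    actions of the group, and normal forms appear only for free products. *)

Section Raag.
Context (G : graph).

Lemma raag_piM (u w : word G) :
  \pi_(presented (@raag_relator G)) (u ++ w) =
  (\pi_(presented (@raag_relator G)) u : raag G) *
  \pi_(presented (@raag_relator G)) w.
Proof.
apply/presentedP/pres_sym.
exact: pres_cat (pres_eq_repr _ _) (pres_eq_repr _ _).
Qed.

Lemma raag_commute (v w : G) : adj v w -> commute (raag_gen v) (raag_gen w).
Proof.
move=> vw; have E : raag_gen v * raag_gen w =
   \pi_(presented (@raag_relator G)) [:: (v, false); (w, false)].
  by rewrite -[[:: _; _]]/([:: _] ++ [:: _]) raag_piM.
have E' : raag_gen w * raag_gen v =
   \pi_(presented (@raag_relator G)) [:: (w, false); (v, false)].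
  by rewrite -[[:: (w, _); _]]/([:: _] ++ [:: _]) raag_piM.
rewrite /commute E E' -[[:: (w, _); _]]cats0.
(* Append the relator to [w v]; its first half cancels and leaves [v w]. *)
have -> : (\pi_(presented (@raag_relator G))
     ([:: (w, false); (v, false)] ++ [::]) : raag G) =
    \pi_(presented (@raag_relator G)) ([:: (w, false); (v, false)] ++
      [:: (v, true); (w, true); (v, false); (w, false)]).
  rewrite !raag_piM; congr (_ * _); apply/presentedP/pres_sym/pres_relator.
  by exists v, w.
rewrite -[_ ++ [:: (v, true); _; _; _]]/(([:: (w, false); (v, false)] ++
  word_inv [:: (w, false); (v, false)]) ++ [:: (v, false); (w, false)]).
rewrite (raag_piM (_ ++ _)).
have -> : (\pi_(presented (@raag_relator G)) ([:: (w, false); (v, false)] ++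
  word_inv [:: (w, false); (v, false)]) : raag G) = 1.
  by apply/presentedP/pres_word_invr.
by rewrite mul1g.
Qed.

Lemma raag_ind (P : raag G -> Prop) :
  P 1 -> (forall v x, P x -> P (raag_gen v * x)) ->
  (forall v x, P x -> P ((raag_gen v)^-1 * x)) -> forall x, P x.
Proof.
move=> P1 Pg PV x.
rewrite -[x]/(x : presented (@raag_relator G)) -[x]reprK.
elim: (repr _) => [//|[v b] w IHw].
rewrite -cat1s raag_piM; case: b => //; last exact: Pg.
suff -> : \pi_(presented (@raag_relator G)) [:: (v, true)] =
          (raag_gen v)^-1 :> raag G by exact: PV.
apply/(mulgI (raag_gen v)); rewrite mulgV -raag_piM.
by apply/presentedP/(pres_cancel _ (v, false)).
Qed.

Section Act.
Context (T : Type) (p q : G -> T -> T).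
Hypotheses (pK : forall v, cancel (p v) (q v)) (qK : forall v, cancel (q v) (p v)).
Hypothesis pC : forall v w, adj v w -> forall t, p v (p w t) = p w (p v t).

(** Letters act by [p] or [q], and congruent words act equally. Homomorphisms, the action on normal
    forms and all test actions come from here; the inverse [q] is an argument so that it can be
    given by a formula. *)
Lemma raag_act_ex : exists act : raag G -> T -> T,
  [/\ act 1 =1 id, forall x y t, act (x * y) t = act x (act y t) &
      forall v, act (raag_gen v) =1 p v].
Proof.
pose lact (l : G * bool) := (if l.2 then q l.1 else p l.1).
pose wact (w : word G) t := foldr lact t w.
have wcat u w t : wact (u ++ w) t = wact u (wact w t).
  by rewrite /wact foldr_cat.
have wE u w : pres_eq (@raag_relator G) u w -> forall t, wact u t = wact w t.
  elim=> //= {u w}.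
  - by move=> u w x _ E1 _ E2 t; rewrite E1.
  - by move=> u1 u2 w1 w2 _ E1 _ E2 t; rewrite !wcat E2 E1.
  - by case=> v [] t; rewrite /wact /lact /= ?qK ?pK.
  - move=> w [v [v' [vv' ->]]] t; rewrite /wact /lact /=.
    by rewrite pC // pK pK.
exists (fun x => wact (repr (x : presented (@raag_relator G)))); split.
- by move=> t; rewrite (wE _ _ (pres_eq_repr _ _)).
- move=> x y t; rewrite -wcat; exact: (wE _ _ (pres_eq_repr _ _)).
- by move=> v t; rewrite (wE _ _ (pres_eq_repr _ _)).
Qed.

End Act.

(** The generators act on [H] by left multiplication by [f v]. Every element then acts as left
    multiplication by its image of [1], and this image is the homomorphism. *)
Lemma raag_lift_ex (H : groupType) (f : G -> H) :
  (forall v w, adj v w -> commute (f v) (f w)) ->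
  exists F : UMagmaMorphism.type (raag G) H, forall v, F (raag_gen v) = f v.
Proof.
move=> fC; pose p v := *%g (f v); pose q v := *%g (f v)^-1.
have [|||F [F1 FM Fg]] := @raag_act_ex H p q.
- by move=> v t; rewrite /p /q mulKg.
- by move=> v t; rewrite /p /q mulVKg.
- by move=> v w vw t; rewrite /p !mulgA fC.
have FE x t : F x t = F x 1 * t.
  elim/raag_ind: x t => [t|v x IHx t|v x IHx t]; first by rewrite !F1 mul1g.
    by rewrite !FM !Fg /p IHx mulgA.
  rewrite !FM (IHx t).
  have FV s : F (raag_gen v)^-1 s = (f v)^-1 * s.
    apply: (mulgI (f v)); rewrite mulVKg -[RHS]F1 -(mulgV (raag_gen v)) FM.
    by rewrite Fg.
  by rewrite !FV mulgA.
pose F' x := F x 1.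
have F'M : monoid_morphism F'.
  by split=> [|x y]; rewrite /F' ?F1 // FM FE.
pose m := isUMagmaMorphism.Build _ _ F' F'M.
exists (HB.pack_for (UMagmaMorphism.type (raag G) H) F' m) => v /=.
by rewrite /F' Fg /p mulg1.
Qed.

End Raag.

(** * Embeddings sending generators to conjugates of generators *)

Lemma act_expg (G : groupType) (T : Type) (act : G -> T -> T) x n t :
  act 1 =1 id -> (forall x y t, act (x * y) t = act x (act y t)) ->
  act (x ^+ n) t = iter n (act x) t.
Proof. by move=> a1 aM; elim: n => [|n IHn]; rewrite ?a1 // expgS aM IHn. Qed.

Definition strong_emb (L G : graph) : Prop :=
  exists f : UMagmaMorphism.type (raag L) (raag G),
    injective f /\ forall v, exists u x, f (raag_gen v) = raag_gen u ^ x.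

Lemma strong_emb_trans (K L G : graph) :
  strong_emb K L -> strong_emb L G -> strong_emb K G.
Proof.
move=> [f [fI fg]] [g [gI gg]].
have gfM : monoid_morphism (g \o f) by split=> [|x y] /=; rewrite ?gmulf1 ?gmulfM.
pose m := isUMagmaMorphism.Build _ _ (g \o f) gfM.
pose h : UMagmaMorphism.type (raag K) (raag G) := HB.pack (g \o f) m.
exists h; split=> [|v]; first exact: inj_comp.
have [u [x E]] := fg v; have [w [y E']] := gg u.
by exists w, (y * g x); rewrite /= E gmulfJ E' conjgM.
Qed.

(** A left inverse of [f] sends [h v] back to [v] and kills the vertices outside the image of [h];
    it respects the relators because [h] reflects adjacency. *)
Lemma raag_induced_inj (L G : graph) (h : L -> G)
    (f : UMagmaMorphism.type (raag L) (raag G)) :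
  injective h -> {mono h : x y / adj x y} ->
  (forall v, f (raag_gen v) = raag_gen (h v)) -> injective f.
Proof.
move=> hI hA fg.
pose r u := if pselect (exists v, h v = u) is left E
  then raag_gen (projT1 (cid E)) else (1 : raag L).
have rh v : r (h v) = raag_gen v.
  rewrite /r; case: pselect => [E|[]]; last by exists v.
  by case: cid => /= a /hI->.
have [|g gg] := @raag_lift_ex G (raag L) r.
  move=> u w uw; rewrite /r; case: pselect => [E|_]; last exact/commute_sym/commute1.
  case: pselect => [E'|_]; last exact: commute1.
  case: cid => [a /= ha]; case: cid => [b /= hb].
  by apply: raag_commute; rewrite -hA ha hb.
apply: (@can_inj _ _ _ g).
elim/raag_ind => [|v x IHx|v x IHx]; first by rewrite !gmulf1.
  by rewrite !gmulfM IHx fg gg rh.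
by rewrite !gmulfM !gmulfV IHx fg gg rh.
Qed.

Lemma strong_emb_induced (L G : graph) (h : L -> G) :
  injective h -> {mono h : x y / adj x y} -> strong_emb L G.
Proof.
move=> hI hA.
have [|f fg] := @raag_lift_ex L (raag G) (fun v => raag_gen (h v)).
  by move=> v w vw; apply: raag_commute; rewrite hA.
exists f; split; last by move=> v; exists (h v), 1; rewrite conjg1.
exact: raag_induced_inj fg.
Qed.

(** * Coverings along the star of a vertex *)

Section Cover.
Context (G : graph) (v : G).
Local Open Scope ring_scope.

(** Copies are indexed by [int] so that the shift is invertible. The copies of a vertex in the link
    of [v] are not glued but see the same vertices; embeddings into the cover only meet the one at
    level 0. *)
Let cov_adj : rel (G * int) := fun x y =>
  adj x.1 y.1 && [|| x.2 == y.2, adj v x.1 | adj v y.1].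

Fact cov_sym : symmetric cov_adj.
Proof.
by move=> x y; rewrite /cov_adj adj_sym eq_sym [adj v x.1 || _]orbC.
Qed.

Fact cov_irr : irreflexive cov_adj.
Proof. by move=> x; rewrite /cov_adj adj_irr. Qed.

Definition star_cover := Graph cov_sym cov_irr.

Lemma star_coverE (x y : star_cover) :
  adj x y = adj x.1 y.1 && [|| x.2 == y.2, adj v x.1 | adj v y.1].
Proof. by []. Qed.

(** Models conjugation by [v ^- j]: the vertices of the link commute with [v] and stay in place. *)
Definition cov_shift (j : int) (x : star_cover) : star_cover :=
  (x.1, if adj v x.1 then x.2 else x.2 + j).

Lemma cov_shift_adj j x y : adj x y -> adj (cov_shift j x) (cov_shift j y).
Proof.
rewrite !star_coverE /=; case: (adj v x.1); case: (adj v y.1);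
  rewrite ?orbT //= !orbF.
by case/andP=> -> /eqP->; rewrite eqxx.
Qed.

End Cover.

(** The vertex [u] of copy [n] goes to [raag_gen u ^ (raag_gen v ^- n)]. For injectivity, [raag G]
    acts on the set [raag C], where [C] is the cover: [v] acts by the automorphism of the shift, any
    other [u] by left multiplication by its copy at level 0. This action replaces the semidirect
    product of [raag C] with the integers; through it [f x] is left multiplication by the image of
    [x] under the embedding [g] into [raag C]. *)
Lemma strong_emb_cover (L G : graph) (v : G) (h : L -> G * nat) :
  injective h -> (forall x, (h x).1 != v) ->
  (forall x, adj v (h x).1 -> (h x).2 = 0) ->
  (forall x y, adj x y = adj (h x).1 (h y).1 &&
     [|| (h x).2 == (h y).2, adj v (h x).1 | adj v (h y).1]) ->
  strong_emb L G.
Proof.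
move=> hI hv h0 hA.
have gC u n : adj v u -> raag_gen u ^ (raag_gen v ^- n) = raag_gen u.
  move=> vu; apply/conjg_fixP/commgP/commuteV/commuteX/commute_sym.
  exact: raag_commute.
have [|f fg] := @raag_lift_ex L (raag G)
    (fun x => raag_gen (h x).1 ^ (raag_gen v ^- (h x).2)).
  move=> x y; rewrite hA => /andP[xy].
  have C n : commute (raag_gen (h x).1 ^ (raag_gen v ^- n))
      (raag_gen (h y).1 ^ (raag_gen v ^- n)).
    by rewrite /commute -!conjMg (raag_commute xy).
  case/or3P => [/eqP->//|vx|vy].
    by rewrite gC // -(gC _ (h y).2 vx).
  by rewrite [X in commute _ X]gC // -(gC _ (h x).2 vy).
exists f; split; last by move=> x; exists (h x).1, (raag_gen v ^- (h x).2).
pose C := star_cover v.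
have shift_ex j : exists s : UMagmaMorphism.type (raag C) (raag C),
    forall x : C, s (raag_gen x) = raag_gen (cov_shift j x).
  by apply: raag_lift_ex => x y xy; apply/raag_commute/cov_shift_adj.
have [s sg] := shift_ex 1%R; have [s' s'g] := shift_ex (-1)%R.
have shK j k (t : UMagmaMorphism.type (raag C) (raag C))
    (t' : UMagmaMorphism.type (raag C) (raag C)) :
    (forall x : C, t (raag_gen x) = raag_gen (cov_shift j x)) ->
    (forall x : C, t' (raag_gen x) = raag_gen (cov_shift k x)) ->
    (j + k = 0)%R -> cancel t t'.
  move=> tg t'g jk.
  have tt'g (x : C) : t' (t (raag_gen x)) = raag_gen x.
    rewrite tg t'g; congr raag_gen; case: x => u i.
    by rewrite /cov_shift /=; case: adj; rewrite -?GRing.addrA ?jk ?GRing.addr0.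
  elim/raag_ind => [|u x IHx|u x IHx]; first by rewrite !gmulf1.
    by rewrite !gmulfM tt'g IHx.
  by rewrite !gmulfM !gmulfV tt'g IHx.
have sK : cancel s s' by apply: (shK 1%R (-1)%R).
have s'K : cancel s' s by apply: (shK (-1)%R 1%R).
pose z (u : G) : C := (u, 0%R : int).
pose p u x := if u == v then s x else raag_gen (z u) * x.
pose q u x := if u == v then s' x else (raag_gen (z u))^-1 * x.
have [|||a [a1 aM ag]] := @raag_act_ex G (raag C) p q.
- by move=> u t; rewrite /p /q; case: eqP; rewrite ?mulKg.
- by move=> u t; rewrite /p /q; case: eqP; rewrite ?mulVKg.
- move=> u w uw t; rewrite /p.
  case: eqP uw => [->|uv]; case: eqP => [->|wv]; rewrite ?adj_irr // => uw.
  + by rewrite gmulfM sg /cov_shift /= uw.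
  + by rewrite gmulfM sg /cov_shift /= adj_sym uw.
  + rewrite !mulgA; congr (_ * _); apply: raag_commute.
    by rewrite star_coverE /= uw.
have aV x t u : a x t = u -> a x^-1 u = t.
  by move=> <-; rewrite -aM mulVg a1.
pose k (x : L) : C := ((h x).1, Posz (h x).2).
have kI : injective k.
  by move=> x y [E1 E2]; apply: hI; case: (h x) (h y) E1 E2 => ? ? [? ?] /= -> ->.
have kA : {mono k : x y / adj x y} by move=> x y; rewrite star_coverE hA.
have [|g gg] := @raag_lift_ex L (raag C) (fun v => raag_gen (k v)).
  by move=> x y xy; apply: raag_commute; rewrite kA.
have gI := raag_induced_inj kI kA gg.
have av n t : a (raag_gen v ^+ n) t = iter n s t.
  rewrite act_expg //; elim: n => //= n ->.
  by rewrite ag /p eqxx.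
have sM n t t' : iter n s (t * t') = iter n s t * iter n s t'.
  by elim: n => //= n ->; rewrite gmulfM.
have sz n u : u != v -> (adj v u -> n = 0) ->
    iter n s (raag_gen (z u)) = raag_gen ((u, Posz n) : C).
  move=> uv n0; have [vu|vu] := boolP (adj v u); first by rewrite n0.
  move: n0 => _.
  elim: n => //= n ->; rewrite sg; apply: (congr1 (@raag_gen C)).
  by rewrite /cov_shift /= (negbTE vu) -PoszD addn1.
(* Conjugating left multiplication by the copy at level 0 with the iterated shift moves that copy to
   level [(h x).2]. *)
have afg x t : a (f (raag_gen x)) t = g (raag_gen x) * t.
  rewrite fg gg conjgE invgK !aM.
  set w := a (raag_gen v ^- _) t.
  have wE : a (raag_gen v ^+ (h x).2) w = t by rewrite -aM mulgV a1.
  rewrite ag /p (negbTE (hv x)) av sM sz //; last exact: h0.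
  by rewrite -av wE.
have afE x t : a (f x) t = g x * t.
  elim/raag_ind: x t => [|u x IHx|u x IHx] t; first by rewrite !gmulf1 a1 mul1g.
    by rewrite !gmulfM aM IHx afg mulgA.
  rewrite !gmulfM !gmulfV aM IHx -mulgA.
  by apply: aV; rewrite afg mulVKg.
apply: gmulf_inj => x fx1; apply: gI; rewrite gmulf1.
by have := afE x 1; rewrite fx1 a1 mulg1 => <-.
Qed.

(** * Forests and the path on four vertices *)

(** If every vertex of [s] had two neighbours in [s], a path could be prolonged forever without
    returning to itself, and would outgrow [s]. *)
Lemma acyclic_leaf (G : graph) (s : seq G) :
  acyclic_graph G -> s != [::] ->
  exists2 w, w \in s & forall x y, x \in s -> y \in s -> adj w x -> adj w y -> x = y.
Proof.
move=> acG s0; apply: contrapT => nleaf.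
have two w : w \in s -> forall y, exists z, [/\ z \in s, adj w z & z != y].
  move=> ws y; apply: contrapT => nz; apply: nleaf; exists w => // x x' xs x's wx wx'.
  have E t : t \in s -> adj w t -> t = y.
    by move=> ts wt; apply/eqP/contraT => ty; case: nz; exists t.
  by rewrite (E x xs wx) (E x' x's wx').
have long n : exists x p,
    [/\ size p = n, path adj x p, uniq (x :: p) & {subset x :: p <= s}].
  elim: n => [|n [x [p [pn xp ux sub]]]].
    case: s s0 {nleaf two} => // x s _; exists x, [::]; split=> // y.
    by rewrite !inE => /eqP->; rewrite eqxx.
  (* [head x p] is the vertex next to [x] on the path; meeting any later one closes a cycle of
     length at least 3. For empty [p] the default [x] is harmless, as [z] is adjacent to [x]. *)
  have [z [zs xz zy]] := two x (sub _ (mem_head _ _)) (head x p).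
  have zx : z != x by apply: contraTneq xz => ->; rewrite adj_irr.
  have [zp|zp] := boolP (z \in p); last first.
    exists z, (x :: p); split.
    - by rewrite /= pn.
    - by rewrite /= adj_sym xz.
    - by rewrite cons_uniq inE negb_or zx zp.
    - by move=> y; rewrite inE => /predU1P[->//|/sub].
  case/splitPr: zp pn xp ux sub zy => p1 p2 _ xp ux _ zy; exfalso.
  apply: (acG (x :: p1 ++ [:: z])).
    by case: p1 zy {xp ux} => [|a p1]; rewrite /= ?eqxx // size_cat addn1.
  rewrite -cat_rcons -cats1 cat_path in xp; case/andP: xp => xp _.
  rewrite /ucycle /cycle rcons_path xp last_cat /= adj_sym xz /=.
  by move: ux; rewrite -cat_rcons -cats1 -cat_cons cat_uniq => /andP[].
have [x [p [pn _ ux sub]]] := long (size s).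
by have := uniq_leq_size ux sub; rewrite /= pn ltnn.
Qed.

(* Nodes of the infinitely branching rooted tree: the list of child indices
   on the way down from the root. *)
Fixpoint node_adj (x y : seq nat) : bool :=
  match x, y with
  | [::], j :: y' => nilp y'
  | i :: x', [::] => nilp x'
  | i :: x', j :: y' => (i == j) && node_adj x' y'
  | [::], [::] => false
  end.

Fact node_adj_sym : symmetric node_adj.
Proof. by elim=> [|i x IHx] [|j y] //=; rewrite IHx eq_sym. Qed.

Fact node_adj_irr : irreflexive node_adj.
Proof. by elim=> //= i x ->; rewrite andbF. Qed.

Definition node_tree : graph := Graph node_adj_sym node_adj_irr.

(** Neighbours of the new node are its parent and its children, and the latter contain the index
    [N]. *)
Lemma node_adj_rcons N u v : N \notin v -> node_adj (rcons u N) v = (v == u).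
Proof.
elim: u v => [|i u IHu] [|j v] //=; rewrite ?inE ?negb_or.
- by case/andP=> /negbTE->.
- by case: u {IHu}.
- by case/andP=> _ /IHu->; rewrite eqseq_cons [i == j]eq_sym.
Qed.

(** Remove a leaf, embed the rest, and put the leaf back as a child with a fresh index. *)
Lemma acyclic_node_emb (G : graph) : finite_graph G -> acyclic_graph G ->
  exists2 h : G -> node_tree, injective h & {mono h : x y / adj x y}.
Proof.
move=> /finite_seqP[s0 sE] acG.
have ex s : uniq s -> exists h : G -> seq nat,
    {in s &, injective h} /\ {in s &, {mono h : x y / adj x y >-> node_adj x y}}.
  have [n] := ubnP (size s); elim: n s => // n IHn s sn us.
  have [->|s_neq0] := eqVneq s [::]; first by exists (fun=> [::]).
  have [w ws wleaf] := acyclic_leaf acG s_neq0.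
  have [|h [hI hA]] := IHn (rem w s) _ (rem_uniq _ us).
    by rewrite size_rem //; case: s s_neq0 sn {us ws wleaf}.
  have memr x : x \in s -> x != w -> x \in rem w s.
    by move=> xs xw; rewrite mem_rem_uniq // !inE xw.
  pose N := (\max_(i <- flatten [seq h y | y <- s]) i).+1.
  have Nh y : y \in s -> N \notin h y.
    move=> ys; apply/negP => Ny.
    suff : N <= \max_(i <- flatten [seq h y | y <- s]) i by rewrite ltnn.
    apply: (@leq_bigmax_seq _ _ xpredT (fun i => i)) => //.
    by apply/flattenP; exists (h y) => //; apply: map_f.
  suff [c [cA cI]] : exists c : seq nat,
      (forall y, y \in s -> y != w -> node_adj c (h y) = adj w y) /\ N \in c.
    exists (fun x => if x == w then c else h x).
    have cN y : y \in s -> c != h y.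
      by move=> ys; apply: contraTneq cI => ->; apply: Nh.
    split=> x y xs ys.
      case: eqP => [->|/eqP xw]; case: eqP => [->//|/eqP yw].
      - by move=> E; have := cN _ ys; rewrite E eqxx.
      - by move=> E; have := cN _ xs; rewrite E eqxx.
      - by apply: hI; apply: memr.
    case: eqP => [->|/eqP xw]; case: eqP => [->|/eqP yw].
    - by rewrite node_adj_irr adj_irr.
    - exact: cA.
    - by rewrite node_adj_sym adj_sym cA.
    - by apply: hA; apply: memr.
  have [[x xs wx]|nx] := pselect (exists2 x, x \in s & adj w x).
    have xw : x != w by apply: contraTneq wx => ->; rewrite adj_irr.
    exists (rcons (h x) N); split; last by rewrite mem_rcons inE eqxx.
    move=> y ys yw; rewrite node_adj_rcons ?Nh //.
    apply/eqP/idP => [/hI E|wy]; last by rewrite (wleaf x y).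
    by rewrite (E (memr _ ys yw) (memr _ xs xw)).
  exists [:: N; N]; split; last by rewrite mem_head.
  move=> y ys yw; have -> : adj w y = false.
    by apply/negP => wy; apply: nx; exists y.
  have := Nh y ys; case: (h y) => //= j v; rewrite inE negb_or => /andP[/negbTE->].
  by [].
have [h [hI hA]] := ex _ (undup_uniq s0).
have mem x : x \in undup s0.
  have : [set: G]%classic x by [].
  by rewrite sE mem_undup.
by exists h => x y; [apply: hI; apply: mem | apply: hA; apply: mem].
Qed.

Definition has_P4 (G : graph) : Prop := exists a b c d : G,
  [/\ adj a b, adj b c, adj c d & [/\ ~~ adj a c, ~~ adj b d & ~~ adj a d]].

(** The cover drawn again as a rooted tree: the old [[:: 0]] becomes the root, its child [i] is the
    old root in copy [i], and branch [j.+1] of that copy becomes branch [j]. The projection to the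
    old tree is [uncover], and the copy is the head of the list. *)
Definition cover_nodes (D : pred (seq nat)) : pred (seq nat) := fun w =>
  match w with
  | [::] => true
  | [:: _] => D [::]
  | _ :: j :: w' => D (j.+1 :: w')
  end.

Definition uncover (w : seq nat) : seq nat :=
  match w with
  | [::] => [:: 0]
  | [:: _] => [::]
  | _ :: j :: w' => j.+1 :: w'
  end.

(* Covering along the star of [0; 0] makes [0] the root of infinitely many
   copies of the part of the tree outside the branch at [0]. *)
Lemma strong_emb_cover_nodes (D : pred node_tree) :
  D [:: 0] -> D [:: 0; 0] ->
  strong_emb (induced (cover_nodes D : pred node_tree)) (induced D).
Proof.
move=> D0 D00.
have Du w : cover_nodes D w -> D (uncover w) by case: w => [|i [|j w]].
pose h (x : induced (cover_nodes D : pred node_tree)) : induced D * nat :=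
  (Sub (uncover (val x)) (Du _ (valP x)), head 0 (val x)).
pose l : induced D := Sub [:: 0; 0] D00.
apply: (@strong_emb_cover _ _ l h).
- move=> [x Dx] [y Dy] [E1 E2]; apply: val_inj => /=.
  by case: x y E1 E2 {Dx Dy} => [|i [|j v]] [|i' [|j' v']] //= E1 E2; congruence.
- by move=> [[|i [|j v]] Dx]; rewrite -val_eqE.
- by move=> [[|i [|j v]] Dx].
- move=> [x Dx] [y Dy]; rewrite /adj /=.
  case: x y {Dx Dy} => [|i [|j v]] [|i' [|j' v']] //=;
    rewrite ?orbF ?orbT ?andbT ?andbF ?eqSS // andbC //.
Qed.

(** The nodes [[:: 1]], [[::]], [[:: 0]], [[:: 0; 0]] form the initial path. They remain present
    after each covering, which can thus be repeated, and after [k] coverings all nodes of depth at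
    most [k] are available. *)
Lemma strong_emb_P4 (L G : graph) :
  finite_graph L -> acyclic_graph L -> has_P4 G -> strong_emb L G.
Proof.
move=> finL acL [a [b [c [d [ab bc cd [ac bd ad]]]]]].
have [h hI hA] := acyclic_node_emb finL acL.
have /finite_seqP[s sE] := finL.
pose n := \max_(x <- s) size (h x).
pose D0 : pred node_tree := mem [:: [::]; [:: 0]; [:: 1%N]; [:: 0; 0]].
pose D k : pred node_tree := iter k cover_nodes D0.
have Dbase k : [/\ D k [::], D k [:: 0], D k [:: 1%N] & D k [:: 0; 0]].
  by elim: k => [|k [E0 E1 E2 E3]] //; split.
have Dsize k w : size w <= k -> D k w.
  elim: k w => [|k IHk] [|i [|j w]] //= sw; have [E0 _ _ _] := Dbase k => //.
  exact: IHk.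
have hD x : D n (h x).
  apply: Dsize; apply: (@leq_bigmax_seq _ _ xpredT (fun x => size (h x))) => //.
  have : [set: L]%classic x by [].
  by rewrite sE.
apply: (@strong_emb_trans _ (induced (D n))).
  pose h' x : induced (D n) := Sub (h x) (hD x).
  by apply: (@strong_emb_induced _ _ h') => [x y [/hI]|x y]; last exact: hA.
elim: n {hD} => [|n IHn]; last first.
  apply: strong_emb_trans IHn.
  by have [_ ? _ ?] := Dbase n; apply: strong_emb_cover_nodes.
pose g (w : seq nat) : G := if w == [::] then b else if w == [:: 0] then c else
  if w == [:: 1%N] then a else d.
have neq (x y z : G) : adj x z -> ~~ adj y z -> (x == y) = false.
  by move=> xz yz; apply: contraNF yz => /eqP<-.
have nab : (a == b) = false by apply: contraTF ab => /eqP->; rewrite adj_irr.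
have nbc : (b == c) = false by apply: contraTF bc => /eqP->; rewrite adj_irr.
have ncd : (c == d) = false by apply: contraTF cd => /eqP->; rewrite adj_irr.
have nac : (a == c) = false by rewrite eq_sym (neq c a d).
have nbd : (b == d) = false by rewrite (neq b d a) // adj_sym.
have nad : (a == d) = false by rewrite (neq a d b) // adj_sym.
pose g' (x : induced (D 0)) := g (val x).
apply: (@strong_emb_induced _ _ g').
  move=> [x Dx] [y Dy] /eqP E; apply: val_inj; move: (Dx) (Dy) E.
  rewrite /g' /D /= /D0 /= !inE.
  case/or4P=> /eqP->; case/or4P=> /eqP->; rewrite /g //=;
  by rewrite ?[_ == a]eq_sym ?[c == b]eq_sym ?[d == _]eq_sym
    ?nab ?nbc ?ncd ?nac ?nbd ?nad.
move=> [x Dx] [y Dy]; rewrite [RHS]/adj /g' /=.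
move: (Dx) (Dy); rewrite /D /= /D0 /= !inE.
case/or4P=> /eqP->; case/or4P=> /eqP->; rewrite /g /= ?adj_irr //;
by rewrite ?[adj _ a]adj_sym ?[adj c b]adj_sym ?[adj d _]adj_sym
  ?ab ?bc ?cd ?(negbTE ac) ?(negbTE bd) ?(negbTE ad).
Qed.

(** * Star forests *)

Definition has_P2 (G : graph) : Prop := exists a b : G, adj a b.
Definition has_2P1 (G : graph) : Prop := exists a b : G, a != b /\ ~~ adj a b.
Definition has_P3 (G : graph) : Prop := exists a b c : G,
  [/\ adj a b, adj b c, a != c & ~~ adj a c].
Definition has_P2P1 (G : graph) : Prop := exists a b t : G,
  [/\ adj a b, ~~ adj t a & ~~ adj t b].
Definition has_P3P1 (G : graph) : Prop := exists a b c t : G,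
  [/\ [/\ adj a b, adj b c, a != c & ~~ adj a c],
      ~~ adj t a, ~~ adj t b & ~~ adj t c].

Lemma acyclic_triangle (G : graph) (x y z : G) : acyclic_graph G ->
  adj x y -> adj y z -> ~~ adj x z.
Proof.
move=> acG xy yz; apply/negP => xz; apply: (acG [:: x; y; z]) => //.
rewrite /ucycle /= xy yz adj_sym xz /= !inE negb_or /=.
by apply/and3P; split=> //; first (apply/andP; split);
  [apply: contraTneq xy | apply: contraTneq xz | apply: contraTneq yz] => ->;
  rewrite adj_irr.
Qed.

Lemma acyclic_square (G : graph) (x y z w : G) : acyclic_graph G ->
  adj x y -> adj y z -> adj z w -> adj w x -> x != z -> y = w.
Proof.
move=> acG xy yz zw wx xz; apply/eqP/contraT => yw; exfalso.
apply: (acG [:: x; y; z; w]) => //.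
rewrite /ucycle /= xy yz zw wx /= !inE !negb_or xz yw /= !andbT.
by apply/and3P; split; [apply/andP; split| |];
  [apply: contraTneq xy | apply: contraTneq wx | apply: contraTneq yz |
   apply: contraTneq zw] => ->; rewrite adj_irr.
Qed.

(* The components of a P4-free forest are stars; [r] selects their centers. *)
Lemma star_forest_root (G : graph) (idx : G -> nat) : injective idx ->
  acyclic_graph G -> ~ has_P4 G -> exists r : G -> G,
    (forall w, r (r w) = r w) /\ forall x y, adj x y =
      [&& x != y, r x == r y & (x == r x) || (y == r y)].
Proof.
move=> iI acG P4free.
pose other (x y : G) := exists z, z != y /\ adj x z.
(* [w] hangs on the centre [x]; on an isolated edge the end of larger index is the centre. *)
pose leaf w x := [/\ adj w x, ~ other w x & other x w \/ idx w < idx x].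
(* Further neighbours [w'] and [x'] at both ends would give an induced path, since there are no
   triangles and no squares. *)
have edge w x : adj w x -> ~ other w x \/ ~ other x w.
  move=> wx; apply: contrapT => /not_orP[/contrapT[w' [w'x ww']]].
  move=> /contrapT[x' [x'w xx']].
  apply: P4free; exists w', w, x, x'; split=> //; first by rewrite adj_sym.
  split.
  - by rewrite adj_sym; apply: (@acyclic_triangle _ x w w') => //; rewrite adj_sym.
  - by apply: (@acyclic_triangle _ w x x').
  - apply: contraNN w'x => w'x'; apply/eqP/esym.
    by apply: (@acyclic_square _ w x x' w') => //;
      by rewrite 1?adj_sym // eq_sym.
have leaf_ex w x : adj w x -> leaf w x \/ leaf x w.
  move=> wx; have xw : adj x w by rewrite adj_sym.
  have [ox|nox] := pselect (other x w).
    by left; split=> //; [case: (edge _ _ wx)|left].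
  have [ow|now_] := pselect (other w x); first by right; split=> //; left.
  case: (ltngtP (idx w) (idx x)) => [ltwx|ltxw|/iI E].
  - by left; split=> //; right.
  - by right; split=> //; right.
  - by rewrite E adj_irr in wx.
have leaf_uniq w x y : leaf w x -> adj w y -> y = x.
  move=> [wx nw _] wy; apply: contrapT => /eqP yx; apply: nw.
  by exists y.
have leaf_center w x y : leaf w x -> ~ leaf x y.
  move=> lwx lxy; have [wx nw ow] := lwx.
  have E : w = y by apply: leaf_uniq lxy _; rewrite adj_sym.
  rewrite -{}E in lxy; have [_ nx ox] := lxy.
  by case: ow => // lt1; case: ox => // lt2; have := ltn_trans lt1 lt2; rewrite ltnn.
pose r w := if pselect (exists x, leaf w x) is left E then projT1 (cid E) else w.
have rleaf w x : leaf w x -> r w = x.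
  move=> lwx; rewrite /r; case: pselect => [E|[]]; last by exists x.
  by case: cid => /= y [wy _ _]; apply: leaf_uniq lwx wy.
have rcenter w x : leaf w x -> r x = x.
  move=> lwx; rewrite /r; case: pselect => // E.
  by have [y lxy] := E; case: (leaf_center _ _ _ lwx lxy).
have rP w : r w = w \/ leaf w (r w).
  have [[x lwx]|nl] := pselect (exists x, leaf w x).
    by right; rewrite (rleaf _ _ lwx).
  by left; rewrite /r; case: pselect.
exists r; split=> [w|x y].
  by case: (rP w) => [E|/rcenter//]; rewrite !E.
apply/idP/and3P => [xy|[xy /eqP rxy]].
  split; first by apply: contraTneq xy => ->; rewrite adj_irr.
    by case: (leaf_ex _ _ xy) => l; rewrite (rleaf _ _ l) (rcenter _ _ l).
  by case: (leaf_ex _ _ xy) => l; rewrite (rcenter _ _ l) eqxx ?orbT.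
case/orP => /eqP E.
  case: (rP y) => [E'|[yr _ _]]; first by rewrite E rxy E' eqxx in xy.
  by rewrite adj_sym E rxy.
case: (rP x) => [E'|[xr _ _]]; first by rewrite E -rxy E' eqxx in xy.
by rewrite E -rxy.
Qed.

(** A star with centre [Some None] and infinitely many leaves [Some (Some i)], beside the isolated
    point [None]. *)
Definition star_pt_adj : rel (option (option nat)) := fun x y =>
  match x, y with
  | Some None, Some (Some _) => true
  | Some (Some _), Some None => true
  | _, _ => false
  end.

Fact star_pt_sym : symmetric star_pt_adj.
Proof. by case=> [[?|]|] [[?|]|]. Qed.

Fact star_pt_irr : irreflexive star_pt_adj.
Proof. by case=> [[?|]|]. Qed.

Definition star_pt : graph := Graph star_pt_sym star_pt_irr.

(** Covering along the end [a] of the path multiplies the other end [c], while the middle vertex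
    [b], in the link of [a], stays single and becomes the centre. *)
Lemma strong_emb_star_pt (G : graph) : has_P3P1 G -> strong_emb star_pt G.
Proof.
move=> [a [b [c [t [[ab bc ac nac] ta tb tc]]]]].
have ba : b != a by apply: contraTneq ab => ->; rewrite adj_irr.
have cb : c != b by apply: contraTneq bc => ->; rewrite adj_irr.
have nta : t != a by apply: contraNneq tb => ->.
have ntb : t != b by apply: contraNneq ta => ->; rewrite adj_sym.
have ntc : t != c by apply: contraNneq tb => ->; rewrite adj_sym.
pose h (x : star_pt) : G * nat :=
  match x with None => (t, 0) | Some None => (b, 0) | Some (Some i) => (c, i) end.
apply: (@strong_emb_cover _ _ a h).
- move=> [[i|]|] [[j|]|] //= [].
  + by move=> ->.
  + by move=> E; rewrite E eqxx in cb.
  + by move=> E; rewrite E eqxx in ntc.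
  + by move=> E; rewrite E eqxx in cb.
  + by move=> E; rewrite E eqxx in ntb.
  + by move=> E; rewrite E eqxx in ntc.
  + by move=> E; rewrite E eqxx in ntb.
- by move=> [[i|]|] //=; rewrite eq_sym.
- by move=> [[i|]|] //=; rewrite (negbTE nac).
- move=> [[i|]|] [[j|]|] //=; rewrite ?adj_irr ?[adj c b]adj_sym ?bc ?ab ?orbT //;
  by rewrite ?[adj _ t]adj_sym ?(negbTE tb) ?(negbTE tc).
Qed.

Section StarForest.
Context (L G : graph) (r : L -> L) (idx : L -> nat).
Hypotheses (idx_inj : injective idx) (rK : forall w, r (r w) = r w).
Hypothesis rE : forall x y, adj x y =
  [&& x != y, r x == r y & (x == r x) || (y == r y)].

Lemma adj_root w : w != r w -> adj w (r w).
Proof. by move=> wr; rewrite rE wr rK !eqxx orbT. Qed.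

(** A second covering, along the isolated point: its link is empty, so the copies of the infinite
    star are disjoint, and each root receives its own. *)
Lemma star_forest_P3P1 : has_P3P1 G -> strong_emb L G.
Proof.
move=> /strong_emb_star_pt; apply: strong_emb_trans.
pose h (x : L) : star_pt * nat :=
  (Some (if x == r x then None else Some (idx x)), idx (r x)).
pose t : star_pt := None.
apply: (@strong_emb_cover _ _ t h).
- move=> x y; rewrite /h; case: eqP => [xr|_]; case: eqP => [yr|_] //= [].
    by rewrite -xr -yr => /idx_inj.
  by move=> /idx_inj.
- by [].
- by [].
- move=> x y; rewrite rE (inj_eq idx_inj) /adj /= !orbF.
  have [xr|xr] := eqVneq x (r x); have [yr|yr] := eqVneq y (r y) => //=;
    rewrite ?orbT ?andbT ?andbF //.
  + by rewrite -xr -yr; case: eqP.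
  + by apply: andb_idl => /eqP E; apply: contraNneq yr => <-; apply/eqP.
  + by apply: andb_idl => /eqP E; apply: contraNneq xr => ->; apply/eqP.
Qed.

(** Without [P3] a root has at most one leaf. Covering along [t], which sees neither [a] nor [b],
    gives disjoint copies of the edge. *)
Lemma star_forest_P2P1 : ~ has_P3 L -> has_P2P1 G -> strong_emb L G.
Proof.
move=> P3free [a [b [t [ab ta tb]]]].
have nab : a != b by apply: contraTneq ab => ->; rewrite adj_irr.
have fib x y : x != r x -> y != r y -> r x = r y -> x = y.
  move=> xr yr rxy; apply/eqP/contraT => xy; case: P3free.
  exists x, (r x), y; split=> //; first exact: adj_root.
    by rewrite rxy adj_sym adj_root.
  by rewrite rE (negbTE xr) (negbTE yr) !andbF.
pose h (x : L) : G * nat := (if x == r x then a else b, idx (r x)).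
apply: (@strong_emb_cover _ _ t h).
- move=> x y; rewrite /h; case: eqVneq => [xr|xr]; case: eqVneq => [yr|yr] //= [].
  + by rewrite -xr -yr => /idx_inj.
  + by move=> E; rewrite E eqxx in nab.
  + by move=> E; rewrite E eqxx in nab.
  + by move=> /idx_inj; apply: fib.
- move=> x; rewrite /h /=; case: ifP => _.
    by apply: contraNneq tb => <-.
  by apply: contraNneq ta => <-; rewrite adj_sym.
- by move=> x; rewrite /h /=; case: ifP => _; rewrite ?(negbTE ta) ?(negbTE tb).
- move=> x y; rewrite rE (inj_eq idx_inj) /h /=.
  have [xr|xr] := eqVneq x (r x); have [yr|yr] := eqVneq y (r y) => //=;
    rewrite ?adj_irr ?[adj b a]adj_sym ?ab ?(negbTE ta) ?(negbTE tb)
      ?orbT ?andbT ?andbF ?orbF //.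
  + by rewrite -xr -yr; case: eqP.
  + by apply: andb_idl => /eqP E; apply: contraNneq yr => <-; apply/eqP.
  + by apply: andb_idl => /eqP E; apply: contraNneq xr => ->; apply/eqP.
Qed.

(** Without [P3 + P1] the star that contains the given [P3] is all of [L]; one covering along [a]
    provides its leaves. *)
Lemma star_forest_P3 : has_P3 L -> ~ has_P3P1 L -> has_P3 G -> strong_emb L G.
Proof.
move=> [x [y [z [xy yz xz nxz]]]] P3P1free [a [b [c [ab bc ac nac]]]].
have ba : b != a by apply: contraTneq ab => ->; rewrite adj_irr.
have cb : c != b by apply: contraTneq bc => ->; rewrite adj_irr.
have rxy : r x = r y by move: xy; rewrite rE => /and3P[_ /eqP].
have ryz : r y = r z by move: yz; rewrite rE => /and3P[_ /eqP].
have r1 w : r w = r y.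
  apply/eqP/contraT => rwy; case: P3P1free; exists x, y, z, w; split=> //;
  by rewrite rE ?rxy -?ryz (negbTE rwy) andbF.
have adjE u w : adj u w = (u != w) && ((u == r y) || (w == r y)).
  by rewrite rE !r1 eqxx.
pose h (x : L) : G * nat := if x == r y then (b, 0) else (c, idx x).
apply: (@strong_emb_cover _ _ a h).
- move=> u w; rewrite /h; case: eqP => [->|_]; case: eqP => [->|_] //= [].
  + by move=> E; rewrite E eqxx in cb.
  + by move=> E; rewrite E eqxx in cb.
  + by move=> /idx_inj.
- by move=> u; rewrite /h; case: ifP => _ //=; rewrite eq_sym.
- by move=> u; rewrite /h; case: ifP => _ //=; rewrite (negbTE nac).
- move=> u w; rewrite adjE /h.
  have [->|ur] := eqVneq u (r y); have [E|wr] := eqVneq w (r y) => //=;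
    rewrite ?eqxx ?adj_irr ?[adj c b]adj_sym ?bc ?ab ?orbT ?andbT ?andbF //.
  by rewrite E ur.
Qed.

End StarForest.

Lemma edgeless_emb (L G : graph) (idx : L -> nat) : injective idx ->
  ~ has_P2 L -> has_2P1 G -> strong_emb L G.
Proof.
move=> iI P2free [a [b [ab nab]]].
apply: (@strong_emb_cover _ _ b (fun x => (a, idx x))) => //=.
- by move=> x y [E]; apply: iI.
- by rewrite adj_sym (negbTE nab).
- by move=> x y; rewrite adj_irr; apply/negP => xy; apply: P2free; exists x, y.
Qed.

(** * Centralizers in free products *)

Section Words.
Context (T : eqType).
Implicit Types X Y B : seq T.

Lemma nseq_catC X B n : X ++ B = B ++ X ->
  X ++ flatten (nseq n B) = flatten (nseq n B) ++ X.
Proof. by move=> XB; elim: n => [|n IHn] /=; rewrite ?cats0 // catA XB -!catA IHn. Qed.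

Lemma size_flatten_nseq n X : size (flatten (nseq n X)) = (n * size X)%N.
Proof. by elim: n => //= n IHn; rewrite size_cat IHn mulSn. Qed.

(** The two powers commute and have the same length, so the two concatenations agree block by
    block. *)
Lemma commuting_words_power X B : X ++ B = B ++ X ->
  flatten (nseq (size B) X) = flatten (nseq (size X) B).
Proof.
move=> XB.
have /eqP := nseq_catC (size B) (esym (nseq_catC (size X) XB)).
rewrite eqseq_cat; first by case/andP=> /eqP.
by rewrite !size_flatten_nseq mulnC.
Qed.

(** A word that commutes with a word [C] at least as long is a prefix of [C]. Both products commute
    with a long power of [B] and have equal length. *)
Lemma commuting_words_trans X Y B : B != [::] ->
  X ++ B = B ++ X -> Y ++ B = B ++ Y -> X ++ Y = Y ++ X.
Proof.
move=> B0 XB YB; pose k := (size X + size Y)%N; pose C := flatten (nseq k B).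
have XC := nseq_catC k XB; have YC := nseq_catC k YB.
have kC : k <= size C.
  by rewrite size_flatten_nseq leq_pmulr // lt0n size_eq0.
have tk Z : size Z = k -> Z ++ C = C ++ Z -> Z = take k C.
  move=> Zk /(congr1 (take k)).
  by rewrite -{1}Zk take_size_cat // takel_cat.
rewrite (tk (X ++ Y)) ?size_cat //; last by rewrite -catA YC !catA XC.
by rewrite (tk (Y ++ X)) ?size_cat 1?addnC // -catA XC !catA YC.
Qed.

End Words.

Lemma morph_V (G H : groupType) (f : G -> H) : {morph f : x y / x * y} ->
  {morph f : x / x^-1}.
Proof.
move=> fM x; have f1 : f 1 = 1 by apply: (mulgI (f 1)); rewrite -fM !mulg1.
by apply: (mulgI (f x)); rewrite -fM !mulgV.
Qed.

Lemma raag_morph_eq (G : graph) (H : groupType) (f g : raag G -> H) :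
  {morph f : x y / x * y} -> {morph g : x y / x * y} ->
  (forall v, f (raag_gen v) = g (raag_gen v)) -> f =1 g.
Proof.
move=> fM gM fg.
have f1 : f 1 = 1 by apply: (mulgI (f 1)); rewrite -fM !mulg1.
have g1 : g 1 = 1 by apply: (mulgI (g 1)); rewrite -gM !mulg1.
elim/raag_ind => [|v x IHx|v x IHx]; first by rewrite f1 g1.
  by rewrite fM gM fg IHx.
by rewrite fM gM !morph_V // fg IHx.
Qed.

(** * Retractions onto the subgroups generated by sets of vertices *)

Section Restriction.
Context (G : graph).
Implicit Types (s t : pred G) (x y : raag G).

(** Killing the vertices outside [s] is an idempotent endomorphism; its fixed points let the groups
    of all induced subgraphs be treated inside [raag G]. *)
Lemma restr_ex s : exists f : UMagmaMorphism.type (raag G) (raag G),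
  forall v, f (raag_gen v) = if s v then raag_gen v else 1.
Proof.
apply: raag_lift_ex => v w vw; case: (s v); last exact/commute_sym/commute1.
by case: (s w); [exact: raag_commute|exact: commute1].
Qed.

Definition restr s := projT1 (cid (restr_ex s)).

Lemma restr_gen s v : restr s (raag_gen v) = if s v then raag_gen v else 1.
Proof. exact: (projT2 (cid (restr_ex s))). Qed.

(* The subgroup generated by the vertices in [s]. *)
Definition in_sub s : pred (raag G) := fun x => restr s x == x.

Lemma restr_restr s t x : restr s (restr t x) = restr (predI s t) x.
Proof.
apply: (@raag_morph_eq _ _ (fun x => restr s (restr t x))) x.
- by move=> x y; rewrite !gmulfM.
- exact: gmulfM.
move=> v; rewrite !restr_gen /=; case: (t v); rewrite ?gmulf1 ?andbF //.
by rewrite restr_gen andbT.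
Qed.

Lemma eq_restr s t : s =1 t -> restr s =1 restr t.
Proof.
move=> st; apply: raag_morph_eq; [exact: gmulfM|exact: gmulfM|].
by move=> v; rewrite !restr_gen st.
Qed.

Lemma in_sub_restr s x : in_sub s (restr s x).
Proof. by rewrite /in_sub restr_restr (eq_restr (t := s)) // => v; rewrite /= andbb. Qed.

Lemma in_subS s t x : {subset s <= t} -> in_sub s x -> in_sub t x.
Proof.
move=> st /eqP E; rewrite /in_sub -E restr_restr (eq_restr (t := s)) ?E // => v /=.
by apply: andb_idl => /st.
Qed.

Lemma in_sub1 s : in_sub s 1.
Proof. by rewrite /in_sub gmulf1. Qed.

Lemma in_subM s x y : in_sub s x -> in_sub s y -> in_sub s (x * y).
Proof. by move=> /eqP E /eqP E'; rewrite /in_sub gmulfM E E'. Qed.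

Lemma in_subV s x : in_sub s x -> in_sub s x^-1.
Proof. by move=> /eqP E; rewrite /in_sub gmulfV E. Qed.

Lemma in_subJ s x y : in_sub s x -> in_sub s y -> in_sub s (x ^ y).
Proof. by move=> /eqP E /eqP E'; rewrite /in_sub gmulfJ E E'. Qed.

Lemma in_subR s x y : in_sub s x -> in_sub s y -> in_sub s [~ x, y].
Proof. by move=> /eqP E /eqP E'; rewrite /in_sub gmulfR E E'. Qed.

Lemma in_sub_gen s v : s v -> in_sub s (raag_gen v).
Proof. by move=> sv; rewrite /in_sub restr_gen sv. Qed.

Lemma in_sub_ind s (P : raag G -> Prop) :
  P 1 -> (forall v x, s v -> in_sub s x -> P x -> P (raag_gen v * x)) ->
  (forall v x, s v -> in_sub s x -> P x -> P ((raag_gen v)^-1 * x)) ->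
  forall x, in_sub s x -> P x.
Proof.
move=> P1 Pg PV x /eqP <-.
elim/raag_ind: x => [|v x IHx|v x IHx]; first by rewrite gmulf1.
  rewrite gmulfM restr_gen; case: ifP => [sv|_]; last by rewrite mul1g.
  by apply: Pg => //; apply: in_sub_restr.
rewrite gmulfM gmulfV restr_gen; case: ifP => [sv|_]; last by rewrite invg1 mul1g.
by apply: PV => //; apply: in_sub_restr.
Qed.

End Restriction.

(** * Normal forms and centralizers when no edge joins the two sides of [s] *)

Section FreeProduct.
Context (G : graph) (s p : pred G).
Hypothesis sepP : forall u v, s u -> s v -> p u != p v -> ~~ adj u v.
Implicit Types (x y b : raag G) (i j : bool) (l : seq (bool * raag G)).

Definition side i : pred G := fun v => s v && (p v == i).

Lemma side_sub i x : in_sub (side i) x -> in_sub s x.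
Proof. by apply: in_subS => v /andP[]. Qed.

(** Membership of the syllables in the sides is left to [valid]: multiplication by a syllable
    preserves [reduced] for any element of [raag G], which makes the reduced words a set to act
    on. *)
Definition reduced l :=
  all (fun q => q.2 != 1) l && sorted (fun q r => q.1 != r.1) l.

Definition valid l := all (fun q => in_sub (side q.1) q.2) l.

Definition ev l : raag G := foldr (fun q g => q.2 * g) 1 l.

Definition syl_cons i x l := if x == 1 then l else (i, x) :: l.

Definition syl_act i x l := match l with
  | (j, y) :: l' => if j == i then syl_cons i (x * y) l' else syl_cons i x l
  | [::] => syl_cons i x [::]
  end.

Lemma reduced_cons (y : bool * raag G) l : reduced (y :: l) =
  [&& y.2 != 1, (if l is z :: _ then y.1 != z.1 else true) & reduced l].
Proof. by case: l => [|z l]; rewrite /reduced /= -!andbA //; do ?bool_congr. Qed.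

Lemma syl_act_reduced i x l : reduced l -> reduced (syl_act i x l).
Proof.
case: l => [|[j y] l]; rewrite /syl_act /syl_cons.
  by case: eqP => // /eqP x1; rewrite reduced_cons x1.
rewrite reduced_cons => /and3P[y1 jl rl]; case: (eqVneq j i) => [<-|ji].
  by case: eqP => // /eqP xy1; rewrite reduced_cons xy1 rl /= andbT.
case: eqP => [_|/eqP x1]; first by rewrite reduced_cons y1 jl.
by rewrite !reduced_cons /= x1 eq_sym ji y1 jl.
Qed.

Lemma syl_act1 i l : reduced l -> syl_act i 1 l = l.
Proof.
case: l => [|[j y] l]; rewrite /syl_act /syl_cons ?eqxx //.
rewrite reduced_cons => /and3P[/= y1 _ _].
by case: eqP => // ->; rewrite mul1g (negbTE y1).
Qed.

Lemma syl_actM i x y l : reduced l -> syl_act i (x * y) l = syl_act i x (syl_act i y l).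
Proof.
have E l' : (if l' is z :: _ then i != z.1 else true) ->
    forall z, syl_act i x (syl_cons i z l') = syl_cons i (x * z) l'.
  move=> il' z; rewrite {1}/syl_cons; case: eqP => [->|_]; last by rewrite /= eqxx.
  by rewrite mulg1; case: l' il' => [|[j w] l'] //=; rewrite eq_sym => /negbTE->.
case: l => [|[j z] l]; first by rewrite /= E.
rewrite reduced_cons => /and3P[_ /= jl _].
case: (eqVneq j i) jl => [ji|ji] jl; first by rewrite E -?ji ?mulgA.
by rewrite E //= 1?eq_sym.
Qed.

Lemma ev_syl_act i x l : ev (syl_act i x l) = x * ev l.
Proof.
case: l => [|[j y] l]; rewrite /syl_act /syl_cons.
  by case: eqP => [->|] /=; rewrite ?mulg1.
case: (j == i); case: eqP => [E|_] //=; rewrite ?mulgA // E mul1g //.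
Qed.

Lemma syl_act_valid i x l : in_sub (side i) x -> valid l -> valid (syl_act i x l).
Proof.
move=> ix; case: l => [|[j y] l]; rewrite /syl_act /syl_cons /=.
  by case: eqP; rewrite /= ?ix.
case/andP=> jy vl; case: (eqVneq j i) jy => [->|ji] /= jy; case: eqP => //= _.
- by rewrite in_subM.
- by rewrite jy.
- by rewrite ix jy.
Qed.

Lemma size_syl_act i x l : size (syl_act i x l) <= (size l).+1.
Proof.
case: l => [|[j y] l]; rewrite /syl_act /syl_cons;
  by do ?[case: ifP => ? //=]; rewrite ltnW.
Qed.

Definition good l := reduced l && valid l.

Lemma good_of_valid l : valid l ->
  exists l', [/\ good l', ev l' = ev l & size l' <= size l].
Proof.
elim: l => [|[i x] l IHl] /=; first by exists [::].
case/andP=> ix /IHl[l' [/andP[rl' vl'] <- sl']]; exists (syl_act i x l'); split.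
- by rewrite /good syl_act_reduced ?syl_act_valid.
- exact: ev_syl_act.
- exact: leq_trans (size_syl_act _ _ _) _.
Qed.

Lemma good_ex x : in_sub s x -> exists2 l, good l & ev l = x.
Proof.
elim/in_sub_ind => [|v {}x sv _ [l /andP[rl vl] <-]|v {}x sv _ [l /andP[rl vl] <-]].
- by exists [::].
- exists (syl_act (p v) (raag_gen v) l); last exact: ev_syl_act.
  by rewrite /good syl_act_reduced ?syl_act_valid //;
  apply: in_sub_gen; rewrite /side sv /=.
- exists (syl_act (p v) (raag_gen v)^-1 l); last exact: ev_syl_act.
  rewrite /good syl_act_reduced ?syl_act_valid //; apply/in_subV/in_sub_gen.
  by rewrite /side sv /=.
Qed.

(* Van der Waerden's trick: the group acts on the set of reduced words. *)
Lemma good_inj l l' : good l -> good l' -> ev l = ev l' -> l = l'.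
Proof.
pose T := {l : seq (bool * raag G) | reduced l}.
pose st i x (t : T) : T := Sub (syl_act i x (val t)) (syl_act_reduced i x (valP t)).
have st1 i t : st i 1 t = t by apply: val_inj; apply/syl_act1/valP.
have stM i x y t : st i x (st i y t) = st i (x * y) t.
  by apply: val_inj; apply/esym/syl_actM/valP.
(* Vertices outside [s] act trivially. Adjacent vertices of [s] lie on one side, where [st] is
   multiplicative, so their actions commute. *)
pose f v t := if s v then st (p v) (raag_gen v) t else t.
pose g v t := if s v then st (p v) (raag_gen v)^-1 t else t.
have [|||a [a1 aM ag]] := @raag_act_ex G T f g.
- by move=> v t; rewrite /f /g; case: (s v); rewrite // stM mulVg st1.
- by move=> v t; rewrite /f /g; case: (s v); rewrite // stM mulgV st1.
- move=> v w vw t; rewrite /f; case sv: (s v) => //; case sw: (s w) => //.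
  have -> : p v = p w by apply/eqP/contraT => /(sepP sv sw); rewrite vw.
  by rewrite !stM raag_commute.
have aside i x t : in_sub (side i) x -> a x t = st i x t.
  move=> ix; elim/in_sub_ind: ix t =>
    [t|v {}x /andP[sv /eqP pv] _ IHx t|v {}x /andP[sv /eqP pv] _ IHx t].
  - by rewrite a1 st1.
  - by rewrite aM ag IHx /f sv pv stM.
  - rewrite aM IHx; set t' := st i x t.
    have -> : a (raag_gen v)^-1 t' = st i (raag_gen v)^-1 t'.
      rewrite -{1}[t'](st1 i) -(mulgV (raag_gen v)) -stM.
      have := ag v (st i (raag_gen v)^-1 t'); rewrite /f sv pv => <-.
      by rewrite -aM mulVg a1.
    by rewrite stM.
pose t0 : T := Sub [::] isT.
(* Acting on the empty word rebuilds the normal form, which is therefore determined by its value. *)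
have aE m : good m -> val (a (ev m) t0) = m.
  elim: m => [|[i x] m IHm]; first by rewrite a1.
  rewrite /good reduced_cons /= => /andP[/and3P[x1 im rm] /andP[ix vm]].
  rewrite aM (aside i) // /= IHm /good ?rm // /syl_act /syl_cons (negbTE x1).
  by case: m im {IHm rm vm} => [|[j y] m] //=; rewrite eq_sym => /negbTE->.
by move=> gl gl' E; rewrite -(aE _ gl) -(aE _ gl') E.
Qed.

Lemma ev_cat l l' : ev (l ++ l') = ev l * ev l'.
Proof. by elim: l => [|q l IHl]; rewrite /= ?mul1g // IHl mulgA. Qed.

Lemma ev_nseq n l : ev (flatten (nseq n l)) = ev l ^+ n.
Proof. by elim: n => //= n IHn; rewrite ev_cat IHn expgS. Qed.

Definition first_side l := (head (true, 1 : raag G) l).1.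
Definition last_side l := (last (true, 1 : raag G) l).1.

Lemma good_cat l l' : good l -> good l' -> last_side l != first_side l' ->
  good (l ++ l').
Proof.
case: l => [|q l]; first by rewrite cat0s.
case: l' => [|q' l']; first by rewrite cats0.
rewrite /good /reduced /valid !all_cat /last_side /first_side /= => gl gl' ll'.
move: gl gl' => /andP[/andP[/andP[-> ->] pl] /andP[-> ->]].
by case/andP=> /andP[/andP[-> ->] pl'] /andP[-> ->]; rewrite cat_path pl /= ll' pl'.
Qed.

(** Meeting syllables of the same side fuse, which makes the normal form of the product strictly
    shorter than the concatenation. *)
Lemma merge l l' : good l -> good l' -> l != [::] -> l' != [::] ->
  last_side l = first_side l' ->
  exists m, [/\ good m, ev m = ev l * ev l' & size m < size l + size l'].
Proof.
case/lastP: l => // l [i x]; case: l' => // [[j y] l'].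
move=> /andP[_ +] /andP[_ +] _ _; rewrite /last_side last_rcons /first_side /=.
rewrite /valid all_rcons /= => /andP[ix vl] /andP[jy vl'] ij.
have [|m [gm mE ms]] := @good_of_valid (l ++ (i, x * y) :: l').
  rewrite /valid all_cat [all _ (_ :: _)]/= -!/(valid _).
  by apply/and3P; split=> //; rewrite /= in_subM // ij.
exists m; split=> //; first by rewrite mE -cats1 !ev_cat /= mulg1 !mulgA.
by rewrite (leq_ltn_trans ms) // size_cat size_rcons /= addSn addnS.
Qed.

Definition inv_word l : seq (bool * raag G) := rev [seq (q.1, q.2^-1) | q <- l].

Lemma ev_inv_word l : ev (inv_word l) = (ev l)^-1.
Proof.
rewrite /inv_word; elim: l => [|q l IHl]; first by rewrite invg1.
by rewrite /= rev_cons -cats1 ev_cat IHl /= mulg1 invgM.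
Qed.

Lemma good_inv_word l : good l -> good (inv_word l).
Proof.
rewrite /good /reduced /valid /inv_word !all_rev !all_map rev_sorted sorted_map.
case/andP=> /andP[nl sl] vl; apply/andP; split; first (apply/andP; split).
- by apply: sub_all nl => q /=; rewrite invg_eq1.
- by apply: sub_sorted sl => q r; rewrite /relpre /= eq_sym.
- by apply: sub_all vl => q; apply: in_subV.
Qed.

Lemma first_inv_word l : l != [::] -> first_side (inv_word l) = last_side l.
Proof.
case/lastP: l => // l q _.
by rewrite /inv_word map_rcons rev_rcons /last_side last_rcons.
Qed.

Lemma last_inv_word l : l != [::] -> last_side (inv_word l) = first_side l.
Proof. by case: l => // q l _; rewrite /inv_word /= rev_cons /last_side last_rcons. Qed.

(** Write [x = a * ev m] with [a] in side [i] and [m] starting on the other side. Then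
    [b ^ a * ev m = ev m * b]; if [m] is not empty, the left normal form starts on side [i] and the
    right one on the other side. *)
Lemma centralizer_elliptic i b x : b != 1 -> in_sub (side i) b -> in_sub s x ->
  commute b x -> in_sub (side i) x.
Proof.
move=> b1 ib /good_ex[l gl <-] bl.
have [a [m [ia gm lE fm]]] : exists a m, [/\ in_sub (side i) a, good m,
    ev l = a * ev m & m != [::] -> first_side m = ~~ i].
  case: l gl {bl} => [|[j y] l] gl; first by exists 1, [::]; rewrite mul1g in_sub1.
  have [ji|ji] := eqVneq j i.
    have := gl; rewrite /good reduced_cons /= => /andP[/and3P[_ lj rl] /andP[jy vl]].
    exists y, l; split=> //; rewrite -?ji //; first exact/andP.
    case: l lj {gl rl vl} => // [[k z] l] /=; rewrite /first_side /=.
    by case: (j) (k) => [] [].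
  exists 1, ((j, y) :: l); split=> //; rewrite ?in_sub1 ?mul1g //.
  by rewrite /first_side /=; case: (j) (i) ji => [] [].
rewrite lE; suff /eqP-> : m == [::] by rewrite mulg1.
apply/negPn/negP => m0; have {fm} fm := fm m0.
pose b' := b ^ a.
have b'm : b' * ev m = ev m * b.
  rewrite /b' conjgE -!mulgA; apply: (mulgI a).
  by rewrite mulVKg -lE bl lE !mulgA.
have gb' : good [:: (i, b')].
  rewrite /good /reduced /valid /= !andbT in_subJ // andbT.
  by rewrite /b' conjg_eq1.
have gb'm : good ((i, b') :: m).
  by apply: (@good_cat [:: _]) => //; rewrite fm /last_side /=; case: (i).
have gb : good [:: (i, b)] by rewrite /good /reduced /valid /= b1 ib.
suff [m' gm' [m'E fm']] : exists2 m', good m' & ev m' = ev m * b /\ first_side m' = ~~ i.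
  have E : (i, b') :: m = m' by apply: good_inj => //=; rewrite m'E.
  by move: fm'; rewrite -E /first_side /=; case: (i).
have fcat l' : first_side (m ++ l') = ~~ i by case: m m0 fm {b'm gb'm lE gm} => //.
have [lm|lm] := eqVneq (last_side m) i; last first.
  exists (m ++ [:: (i, b)]); last by rewrite ev_cat /= mulg1 fcat.
  by apply: good_cat.
have [m1 [y mE]] : exists m1 y, m = rcons m1 (i, y).
  case/lastP: m m0 lm {fm b'm gb'm lE gm fcat} => // m [j y] _.
  by rewrite /last_side last_rcons /= => ->; exists m, y.
move: gm fm; rewrite mE => gm fm {fcat gb'm b'm lE m0 lm mE m}.
(* [m] starts and ends on different sides, so [m1] is not empty and keeps the first syllable even if
   [y] cancels against [b]. *)
have m1f l' : first_side (m1 ++ l') = ~~ i.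
  case: m1 gm fm => [|q m1] //= _.
  by rewrite /first_side /=; case: (i).
have iy : in_sub (side i) y by move: gm; rewrite /good /valid all_rcons => /and3P[].
have [[y1 nm1] sm1 vm1] : [/\ y != 1 /\ all (fun q => q.2 != 1) m1,
    sorted (fun q r => q.1 != r.1) (rcons m1 (i, y)) & valid m1].
  move: gm; rewrite /good /reduced /valid !all_rcons.
  by case/andP=> /andP[/andP[-> ->] ->] /andP[_ ->].
have evE : ev (rcons m1 (i, y)) * b = ev m1 * (y * b).
  by rewrite -cats1 ev_cat /= mulg1 mulgA.
have [yb1|yb1] := eqVneq (y * b) 1.
  exists m1; last by rewrite evE yb1 mulg1 -[m1]cats0 m1f.
  rewrite /good /reduced nm1 vm1 andbT /=.
  by move: sm1; rewrite -cats1; case: (m1) => //= q l'; rewrite cat_path => /andP[].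
exists (rcons m1 (i, y * b)); last by rewrite evE -cats1 ev_cat /= mulg1 m1f.
rewrite /good /reduced /valid !all_rcons nm1 /= yb1 in_subM //= -/(valid m1) vm1 !andbT.
by move: sm1; case: (m1) => //= q l'; rewrite !rcons_path.
Qed.

(** Single syllables are excluded, so powers of such a word are reduced as they stand. *)
Definition cyclically_reduced l := (l != [::]) && (last_side l != first_side l).

Lemma centralizer_word l x : good l -> cyclically_reduced l -> in_sub s x ->
  commute (ev l) x -> exists2 m, good m &
    m ++ l = l ++ m /\ (ev m = x \/ ev m = x^-1).
Proof.
move=> gl /andP[l0 cl] /good_ex[m gm <-] lm.
have [->|m0] := eqVneq m [::]; first by exists [::] => //; split; [rewrite cats0|left].
have big l1 l2 : good l1 -> good l2 -> l1 != [::] -> l2 != [::] ->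
    ev l1 * ev l2 = ev l2 * ev l1 ->
    last_side l1 != first_side l2 -> last_side l2 = first_side l1 -> False.
  move=> g1 g2 n1 n2 E ne eq.
  have [m' [gm' m'E m's]] := merge g2 g1 n2 n1 eq.
  have E' : m' = l1 ++ l2.
    by apply: good_inj => //; [apply: good_cat|rewrite ev_cat m'E E].
  by move: m's; rewrite E' size_cat addnC ltnn.
have [ml|ml] := eqVneq (last_side m) (first_side l);
  have [lm'|lm'] := eqVneq (last_side l) (first_side m).
- exists (inv_word m); first exact: good_inv_word.
  split; last by right; rewrite ev_inv_word.
  apply: good_inj.
  + apply: good_cat => //; first exact: good_inv_word.
    by rewrite last_inv_word // -lm'.
  + apply: good_cat => //; first exact: good_inv_word.
    by rewrite first_inv_word // ml.
  + by rewrite !ev_cat ev_inv_word; apply/commute_sym/commuteV.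
- by case: (big l m).
- by case: (big m l) => //; rewrite lm.
- exists m => //; split; last by left.
  by apply: good_inj; rewrite ?ev_cat ?lm //; apply: good_cat.
Qed.

Lemma centralizer_hyperbolic l x y : good l -> cyclically_reduced l ->
  in_sub s x -> in_sub s y -> commute (ev l) x -> commute (ev l) y ->
  commute x y.
Proof.
move=> gl cl sx sy lx ly; have [l0 _] := andP cl.
have [m _ [ml mE]] := centralizer_word gl cl sx lx.
have [m' _ [m'l m'E]] := centralizer_word gl cl sy ly.
have /(congr1 ev) := commuting_words_trans l0 ml m'l; rewrite !ev_cat => mm'.
have {mm'} : commute (ev m) (ev m') by [].
have cV (u w : raag G) : commute u w^-1 -> commute u w.
  by move=> uw; rewrite -[w]invgK; apply: commuteV.
have cV' (u w : raag G) : commute u^-1 w -> commute u w.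
  by move=> uw; apply/commute_sym/cV/commute_sym.
by case: mE m'E => [->|->] [->|->]; [|move/cV|move/cV'|move/cV/cV'].
Qed.

Lemma root_hyperbolic l x : good l -> cyclically_reduced l ->
  in_sub s x -> commute (ev l) x ->
  exists m n, 0 < m /\ (x ^+ m = ev l ^+ n \/ x ^+ m = ev l ^- n).
Proof.
move=> gl cl sx lx; have [l0 _] := andP cl.
have [m _ [ml mE]] := centralizer_word gl cl sx lx.
have /(congr1 ev) := commuting_words_power ml; rewrite !ev_nseq => E.
exists (size l), (size m); split; first by rewrite lt0n size_eq0.
by case: mE => mE; rewrite mE in E; [left|right; rewrite -E expVgn invgK].
Qed.

(** When the first and last syllables lie on the same side, conjugation by the first one moves it to
    the end, where it fuses with the last, and the word gets shorter. *)
Lemma conjugate_cyclically_reduced b : in_sub s b -> b != 1 ->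
  exists2 g, in_sub s g & (exists i, in_sub (side i) (b ^ g)) \/
    exists2 l, good l /\ cyclically_reduced l & ev l = b ^ g.
Proof.
move=> /good_ex[l gl <-] {b}.
have [n] := ubnP (size l); elim: n l gl => // n IHn [|[i x] m] gl sl.
  by rewrite eqxx.
case/lastP: m gl sl => [|m [j y]] gl sl l1.
  exists 1; first exact: in_sub1.
  left; exists i; rewrite conjg1 /= mulg1.
  by move: gl; rewrite /good /valid /= => /and3P[].
have [ji|ji] := eqVneq j i; last first.
  exists 1; first exact: in_sub1.
  right; exists ((i, x) :: rcons m (j, y)); last by rewrite conjg1.
  by split=> //; rewrite /cyclically_reduced /last_side /first_side /= last_rcons.
have := gl; rewrite /good /valid /= all_rcons /= => /andP[_ /and3P[ix jy vm]].
have [|m' [gm' m'E sm']] := @good_of_valid (rcons m (i, y * x)).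
  by rewrite /valid all_rcons /= in_subM // -ji.
have E : ev m' = ev ((i, x) :: rcons m (j, y)) ^ x.
  rewrite m'E conjgE /= -!cats1 !ev_cat /= !mulg1.
  by rewrite !mulgA mulVg mul1g.
have [||g sg gP] := IHn _ gm'.
- by rewrite (leq_ltn_trans sm') // size_rcons; move: sl; rewrite /= size_rcons.
- by rewrite E conjg_eq1.
exists (x * g); first by rewrite in_subM // (side_sub ix).
by rewrite conjgM -E.
Qed.

(** The dichotomy behind the free product step of the group laws. In the second case the centralizer
    is abelian and commensurable to the powers of [b]; both facts are recorded, for different
    laws. *)
Lemma centralizer_free_product b : in_sub s b -> b != 1 ->
  (exists2 g, in_sub s g & exists i, in_sub (side i) (b ^ g)) \/
  forall x y, in_sub s x -> in_sub s y -> commute b x -> commute b y ->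
    commute x y /\
    exists m n, 0 < m /\ (x ^+ m = b ^+ n \/ x ^+ m = b ^- n).
Proof.
move=> sb b1; have [g sg [[i ib]|[l [gl cl] lE]]] := conjugate_cyclically_reduced sb b1.
  by left; exists g => //; exists i.
right=> x y sx sy bx by_.
have cJ u w : commute u w -> commute (u ^ g) (w ^ g).
  by rewrite /commute -!conjMg => ->.
split.
  have : (x ^ g) * (y ^ g) = (y ^ g) * (x ^ g).
    apply: (centralizer_hyperbolic gl cl); rewrite ?in_subJ // lE; exact: cJ.
  by rewrite -!conjMg => /conjg_inj.
have [||m [n [m0 mn]]] := @root_hyperbolic l (x ^ g) gl cl; rewrite ?in_subJ //.
  by rewrite lE; apply: cJ.
exists m, n; split=> //; move: mn; rewrite lE -!conjXg -conjVg.
by case=> /conjg_inj; [left|right].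
Qed.

End FreeProduct.

(** * Cographs *)

Section Cograph.
Context (T : eqType).
Implicit Types (e : rel T) (s : seq T) (p q : pred T).

(** The four vertices need not be distinct: when two coincide, a symmetric [e] provides one of the
    three edges anyway. *)
Definition P4_free e s : Prop := forall a b c d,
  a \in s -> b \in s -> c \in s -> d \in s -> e a b -> e b c -> e c d ->
  [|| e a c, e b d | e a d].

Definition separated e s p : Prop := forall u v,
  u \in s -> v \in s -> p u -> ~~ p v -> ~~ e u v.

Definition joined e s p : Prop := forall u v,
  u \in s -> v \in s -> p u -> ~~ p v -> e u v.

Definition proper_split s p : bool := has p s && has (predC p) s.

Let splits (e : rel T) s :=
  exists2 p, proper_split s p & separated e s p \/ joined e s p.

Let coE e : rel T := fun x y => (x != y) && ~~ e x y.

(** The complement of the path [a b c d] is the path [b d a c]. *)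
Lemma P4_free_co e s : symmetric e -> P4_free e s -> P4_free (coE e) s.
Proof.
move=> eS P4f a b c d aS bS cS dS; rewrite /coE.
move=> /andP[ab nab] /andP[bc nbc] /andP[cd ncd]; apply: contraT.
rewrite !negb_or !negb_and !negbK => /and3P[ac bd ad].
have {}ac : e a c.
  case/orP: ac => // /eqP E; move: ad; rewrite E (negbTE cd) /= => ecd.
  by rewrite ecd in ncd.
have {}bd : e b d.
  case/orP: bd => // /eqP E; move: ad; rewrite -E (negbTE ab) /= => eab.
  by rewrite eab in nab.
have {}ad : e a d.
  by case/orP: ad => // /eqP E; move: ncd; rewrite -E eS ac.
have := P4f b d a c bS dS aS cS bd; rewrite eS ad => /(_ isT ac).
by rewrite [e b a]eS [e d c]eS (negbTE nab) (negbTE nbc) (negbTE ncd).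
Qed.

Lemma splitsC e s : symmetric e -> uniq s -> splits (coE e) s -> splits e s.
Proof.
move=> eS us [p pS P]; exists p => //.
case: P => P; [right|left] => u v uS vS pu pv.
  have := P u v uS vS pu pv; rewrite /coE negb_and !negbK.
  by case/orP=> // /eqP E; rewrite E (negbTE pv) in pu.
by have /andP[] := P u v uS vS pu pv.
Qed.

(** Each side of [p], with [v] added, is split by the induction hypothesis. Either this splits
    [v :: s], or the side contains a neighbour [x] of [v] adjacent to all its vertices that [v] does
    not see. If both sides yield such a vertex, [v] is joined to all of [s]. *)
Lemma P4_free_separated_cons e v s p : symmetric e -> P4_free e (v :: s) ->
  uniq (v :: s) -> proper_split s p -> separated e s p ->
  (forall t, size t <= size s -> 1 < size t -> uniq t -> {subset t <= v :: s} ->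
     splits e t) ->
  splits e (v :: s).
Proof.
move=> eS P4f /= /andP[vs us] ps sep IH.
have half p' : proper_split s p' -> separated e s p' -> splits e (v :: s) \/
    exists2 x, x \in s /\ p' x & e v x /\
      forall y, y \in s -> p' y -> e v y \/ e y x.
  move=> /andP[hp hc] sep'; pose t := filter p' s.
  have [||||q qS Q] := IH (v :: t).
  - rewrite /= size_filter -(count_predC p' s) -addn1 leq_add2l.
    by rewrite -has_count.
  - by rewrite /= ltnS size_filter -has_count.
  - by rewrite /= mem_filter negb_and vs orbT filter_uniq.
  - by move=> y; rewrite !inE mem_filter => /orP[->|/andP[_ ->]] //; rewrite orbT.
  have {q qS Q} [q qv [qS Q]] : exists2 q : pred T, q v & has (predC q) t /\
      (separated e (v :: t) q \/ joined e (v :: t) q).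
    move: qS; rewrite /proper_split /=; case qv: (q v) => /=.
      by move=> qS; exists q.
    rewrite andbT => qS; exists (predC q); first by rewrite /= qv.
    split; first by apply: sub_has qS => x /=; rewrite negbK.
    case: Q => Q; [left|right] => x y xS yS /= qx; rewrite negbK => qy;
    by rewrite eS; apply: Q.
  have [x xt qx] := hasP qS; rewrite mem_filter in xt; have [p'x xs] := andP xt.
  (* If [v :: t] is separated, its part outside [q] splits off from all of [v :: s]. If it is
     joined, [x] sees [v] and all of [q], while [v] sees everything outside [q]. *)
  case: Q => Q; [left|right].
    exists (fun u => [&& u \in t & ~~ q u]).
      apply/andP; split; apply/hasP.
        by exists x; rewrite ?inE ?xs ?orbT // mem_filter p'x xs.
      by exists v; rewrite ?mem_head //= mem_filter (negbTE vs) andbF.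
    left=> u w _ wS /andP[ut qu]; rewrite negb_and negbK.
    have := ut; rewrite mem_filter => /andP[p'u us'].
    move: wS; rewrite inE => /predU1P[-> _|ws].
      by rewrite eS; apply: Q; rewrite ?inE ?eqxx ?ut ?orbT.
    rewrite mem_filter ws andbT; have [p'w /= qw|p'w _] := boolP (p' w).
      by rewrite eS; apply: Q; rewrite ?inE ?ut ?mem_filter ?p'w ?ws ?orbT.
    exact: sep'.
  exists x => //; split.
    by apply: Q; rewrite ?mem_head // inE mem_filter p'x xs orbT.
  move=> y ys p'y; have yt : y \in v :: t by rewrite inE mem_filter p'y ys orbT.
  have xt' : x \in v :: t by rewrite inE mem_filter p'x xs orbT.
  have [qy|qy] := boolP (q y); first by right; apply: Q.
  by left; apply: Q; rewrite ?mem_head.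
have [//|[x [xs px] [vx xP]]] := half p ps sep.
have [||//|[z [zs /= pz] [vz zP]]] := half (predC p).
- case/andP: ps => h1 h2; rewrite /proper_split h2 /=.
  by apply: sub_has h1 => u /=; rewrite negbK.
- by move=> u w us' ws /= pu; rewrite negbK eS => pw; apply: sep.
have mem u : u \in s -> u \in v :: s by rewrite inE orbC => ->.
(* A vertex [y] of [s] not adjacent to [v] would start an induced path [y], [x], [v], [z] or [y],
   [z], [v], [x]. *)
exists (pred1 v).
  rewrite /proper_split /= eqxx /=; apply/hasP; exists x => //=.
  by apply: contraTneq xs => ->.
right=> u y _ yS /eqP-> /= yv.
have {yv}ys : y \in s by move: yS; rewrite inE (negbTE yv).
have [py|py] := boolP (p y).
  case: (xP _ ys py) => // yx; apply: contraT => vy.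
  have := P4f y x v z (mem _ ys) (mem _ xs) (mem_head _ _) (mem _ zs) yx.
  rewrite eS vx => /(_ isT vz).
  by rewrite eS (negbTE vy) (negbTE (sep _ _ xs zs px pz)) (negbTE (sep _ _ ys zs py pz)).
case: (zP _ ys py) => // yz; apply: contraT => vy.
have := P4f y z v x (mem _ ys) (mem _ zs) (mem_head _ _) (mem _ xs) yz.
rewrite eS vz => /(_ isT vx).
rewrite eS (negbTE vy) [e z x]eS (negbTE (sep _ _ xs zs px pz)).
by rewrite [e y x]eS (negbTE (sep _ _ xs ys px py)).
Qed.

(** The induction runs over all relations at once: a joined splitting of the tail is a separated one
    for the complement, which is P4-free too. *)
Lemma P4_free_split e s : symmetric e -> P4_free e s -> uniq s -> 1 < size s ->
  exists2 p, proper_split s p & separated e s p \/ joined e s p.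
Proof.
have [n] := ubnP (size s); elim: n e s => // n IHn e [|v s] //= sn eS P4f us s1.
have sub t : {subset t <= v :: s} -> P4_free e t.
  by move=> st a b c d /st aS /st bS /st cS /st; apply: P4f.
have [s2|s2] := leqP (size s) 1.
  case: s s1 s2 us {sn P4f sub} => [|w [|? ?]] //= _ _; rewrite inE andbT => vw.
  exists (pred1 v); first by rewrite /proper_split /= eqxx eq_sym (negbTE vw).
  case evw: (e v w); [right|left] => x y; rewrite !inE => _ /orP[] /eqP->;
    by move=> /eqP->; rewrite ?eqxx // evw.
have us' : uniq s by case/andP: us.
have [p ps P] : splits e s.
  by apply: IHn => //; apply: sub => x; rewrite inE orbC => ->.
case: P => P.
  apply: (P4_free_separated_cons eS P4f us ps P) => t ts t1 ut st.
  by apply: IHn => //; [exact: leq_ltn_trans ts sn | exact: sub].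
have coS : symmetric (coE e) by move=> x y; rewrite /coE eq_sym eS.
apply: splitsC => //; apply: (P4_free_separated_cons coS _ us ps).
- exact: P4_free_co.
- by move=> u w us'' ws pu pw; rewrite /coE negb_and !negbK P ?orbT.
- move=> t ts t1 ut st; apply: IHn => //; first exact: leq_ltn_trans ts sn.
  by apply: P4_free_co => //; apply: sub.
Qed.

End Cograph.

(** * Joins and induction on cographs *)

Section Subgroups.
Context (G : graph).
Implicit Types (s p : pred G) (x y : raag G) (i : bool).

Lemma in_subT x : in_sub xpredT x.
Proof.
apply/eqP; apply: (@raag_morph_eq _ _ (restr xpredT) id) x => //; first exact: gmulfM.
by move=> v; rewrite restr_gen.
Qed.

Lemma commute_gen s x y : (forall v, s v -> commute (raag_gen v) y) ->
  in_sub s x -> commute x y.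
Proof.
move=> sC; elim/in_sub_ind => [|v {}x sv _ xy|v {}x sv _ xy].
- exact/commute_sym/commute1.
- by apply/commute_sym/commuteM; apply/commute_sym => //; apply: sC.
- apply/commute_sym/commuteM; last exact/commute_sym.
  exact/commuteV/commute_sym/sC.
Qed.

Lemma commute_sub s s' x y : (forall u v, s u -> s' v -> u != v -> adj u v) ->
  in_sub s x -> in_sub s' y -> commute x y.
Proof.
move=> ss' sx s'y; apply: commute_gen sx => v sv.
apply/commute_sym; apply: commute_gen s'y => w s'w.
have [->|wv] := eqVneq w v; first exact: commute_refl.
by apply/commute_sym/raag_commute/ss' => //; rewrite eq_sym.
Qed.

(** The exponent sum of [v]: let [v] translate [int] by one and the other generators act
    trivially. *)
Lemma exponent_ex (v : G) : exists2 f : raag G -> int,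
  forall x y, f (x * y) = (f x + f y)%R & forall u, f (raag_gen u) = Posz (u == v).
Proof.
pose p u (k : int) := if u == v then (k + 1)%R else k.
pose q u (k : int) := if u == v then (k - 1)%R else k.
have [|||a [a1 aM ag]] := @raag_act_ex G int p q.
- by move=> u k; rewrite /p /q; case: eqP; rewrite // GRing.addrK.
- by move=> u k; rewrite /p /q; case: eqP; rewrite // GRing.subrK.
- by move=> u w _ k; rewrite /p; do ![case: eqP].
have aE x k : a x k = (a x 0 + k)%R.
  elim/raag_ind: x k => [|u x IHx|u x IHx] k.
  - by rewrite !a1 GRing.add0r.
  - rewrite !aM !ag /p IHx; case: eqP => // _.
    by rewrite -!GRing.addrA [(k + 1)%R]GRing.addrC.
  - have aV j : a (raag_gen u)^-1 j = (if u == v then j - 1 else j)%R.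
      rewrite -[RHS]a1 -(mulVg (raag_gen u)) aM ag /p.
      by case: eqP; rewrite // GRing.subrK.
    rewrite !aM !aV IHx; case: eqP => // _.
    by rewrite -!GRing.addrA [(k - 1)%R]GRing.addrC.
exists (a^~ 0%R) => [x y|u]; first by rewrite aM aE.
by rewrite ag /p; case: eqP.
Qed.

Lemma raag_gen_neq1 (v : G) : raag_gen v != 1 :> raag G.
Proof.
have [f fM fg] := exponent_ex v; apply/eqP => v1.
have f1 : f 1 = Posz 1 by rewrite -v1 fg eqxx.
by have := fM 1 1; rewrite mulg1 f1.
Qed.

(** Vertices of the extension graph of the subgraph on [s]: the conjugator also lies in the subgroup
    of [s], so that induction on [s] applies. *)
Definition vert s x : Prop := exists v g, [/\ s v, in_sub s g & x = raag_gen v ^ g].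

Lemma vert_neq1 s x : vert s x -> x != 1.
Proof. by case=> v [g [_ _ ->]]; rewrite conjg_eq1 raag_gen_neq1. Qed.

Lemma vert_in_sub s x : vert s x -> in_sub s x.
Proof. by case=> v [g [sv sg ->]]; rewrite in_subJ // in_sub_gen. Qed.

Lemma vertJ s x g : in_sub s g -> vert s x -> vert s (x ^ g).
Proof.
move=> sg [v [h [sv sh ->]]]; exists v, (h * g); split=> //; first exact: in_subM.
by rewrite conjgM.
Qed.

(** The retraction onto the side fixes [x], and would kill it if its generator were outside the
    side. *)
Lemma vert_side s p i x : vert s x -> in_sub (side s p i) x -> vert (side s p i) x.
Proof.
move=> vx /eqP xE; have [v [g [sv sg E]]] := vx.
move: xE; rewrite {1}E gmulfJ restr_gen; case: ifP => [iv|_] xE; last first.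
  by have := vert_neq1 vx; rewrite -xE conj1g eqxx.
by exists v, (restr (side s p i) g); split=> //; apply: in_sub_restr.
Qed.

Lemma vert_elliptic s p x : vert s x ->
  exists2 g, in_sub s g & exists i, in_sub (side s p i) (x ^ g).
Proof.
case=> v [g [sv sg ->]]; exists g^-1; first exact: in_subV.
by exists (p v); rewrite conjgK in_sub_gen // /side sv /=.
Qed.

Definition separated_on s p : Prop :=
  forall u v, s u -> s v -> p u != p v -> ~~ adj u v.

Definition joined_on s p : Prop :=
  forall u v, s u -> s v -> p u != p v -> adj u v.

Section Join.
Context (s p : pred G).
Hypothesis joinP : joined_on s p.
Let r i := restr (side s p i).

Lemma commute_sides i x y : in_sub (side s p i) x -> in_sub (side s p (~~ i)) y ->
  commute x y.
Proof.
apply: commute_sub => u v /andP[su /eqP pu] /andP[sv /eqP pv] _.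
by apply: joinP => //; rewrite pu pv; case: (i).
Qed.

Lemma join_decomp i x : in_sub s x -> x = r i x * r (~~ i) x.
Proof.
move/eqP => {1}<-.
apply: (@raag_morph_eq _ _ (restr s) (fun x => r i x * r (~~ i) x)) x.
- exact: gmulfM.
- move=> x y; rewrite !gmulfM -!mulgA; congr (_ * _); rewrite !mulgA; congr (_ * _).
  by apply: (@commute_sides i); apply: in_sub_restr.
- move=> v; rewrite !restr_gen /side; case: (s v) => /=; last by rewrite mulg1.
  by case: (p v); case: (i); rewrite /= ?mulg1 ?mul1g.
Qed.

Lemma join_eq1 x : in_sub s x -> (forall i, r i x = 1) -> x = 1.
Proof. by move=> sx rx; rewrite (join_decomp true sx) !rx mulg1. Qed.

(** The component of the conjugator in the other factor commutes with the generator and drops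
    out. *)
Lemma vert_join x : vert s x -> exists i, vert (side s p i) x.
Proof.
case=> v [g [sv sg ->]]; exists (p v); exists v, (r (p v) g); split.
- by rewrite /side sv /=.
- exact: in_sub_restr.
rewrite {1}(join_decomp (~~ p v) sg) negbK conjgM; congr (_ ^ _).
apply/conjg_fixP/commgP; apply: (@commute_sides (p v)); last exact: in_sub_restr.
by apply: in_sub_gen; rewrite /side sv /=.
Qed.

Lemma vert_join_same i j x y : vert (side s p i) x -> vert (side s p j) y ->
  ~ commute x y -> i = j.
Proof.
move=> /vert_in_sub ix /vert_in_sub jy xy; case: (eqVneq i j) => // ij.
case: xy; apply: (@commute_sides i) => //.
by have -> : ~~ i = j by case: (i) (j) ij => [] [].
Qed.

End Join.

Definition P4_free_on s : Prop := forall a b c d, s a -> s b -> s c -> s d ->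
  adj a b -> adj b c -> adj c d -> [|| adj a c, adj b d | adj a d].

Lemma not_P4_free_on s : ~ has_P4 G -> P4_free_on s.
Proof.
move=> P4f a b c d _ _ _ _ ab bc cd; apply/negPn/negP.
by rewrite !negb_or => /and3P[ac bd ad]; apply: P4f; exists a, b, c, d.
Qed.

(** Each step also provides the inclusion in [s0], through which assumptions on [s0] descend, and a
    vertex on each side, which serves as isolated vertex or as common neighbour. *)
Lemma cograph_ind (P : pred G -> Prop) s0 : finite_graph G -> P4_free_on s0 ->
  (forall s, (forall u v, s u -> s v -> u = v) -> P s) ->
  (forall s p, {subset s <= s0} -> (forall i, exists v, side s p i v) ->
    separated_on s p -> (forall i, P (side s p i)) -> P s) ->
  (forall s p, {subset s <= s0} -> (forall i, exists v, side s p i v) ->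
    joined_on s p -> (forall i, P (side s p i)) -> P s) ->
  P s0.
Proof.
move=> /finite_seqP[e eE] P4f Psmall Psep Pjoin.
have eT v : v \in e by have : [set: G]%classic v by []; rewrite eE.
suff H : forall s : seq G, uniq s -> {subset s <= s0} -> P (fun v => v \in s).
  have <- : (fun v => v \in filter s0 (undup e)) = s0.
    by apply: funext => v; rewrite mem_filter mem_undup eT andbT.
  apply: H; first by rewrite filter_uniq ?undup_uniq.
  by move=> v; rewrite mem_filter => /andP[].
move=> s; have [n] := ubnP (size s); elim: n s => // n IHn s sn us ss0.
have [s1|s1] := leqP (size s) 1.
  apply: Psmall; case: s s1 {sn us ss0} => [|w [|? ?]] // _ u v.
  by rewrite !inE => /eqP-> /eqP.
have [||p /andP[hp hn] sep] := @P4_free_split _ (@adj G) s _ _ us s1.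
- exact: adj_sym.
- by move=> a b c d aS bS cS dS; apply: P4f; apply: ss0.
have hi i : exists v, side (fun v => v \in s) p i v.
  case: i; [have /hasP[v vs pv] := hp|have /hasP[v vs /= pv] := hn]; exists v;
    by rewrite /side vs /= -?(negbTE pv) ?pv ?eqxx.
have IH i : P (side (fun v => v \in s) p i).
  have -> : side (fun v => v \in s) p i = (fun v => v \in filter (fun v => p v == i) s).
    by apply: funext => v; rewrite /side mem_filter andbC.
  apply: IHn; rewrite ?filter_uniq //; last first.
    by move=> v; rewrite mem_filter => /andP[_ /ss0].
  apply: (@leq_trans (size s)) => //; rewrite size_filter.
  have [v /andP[vs pv]] := hi (~~ i).
  rewrite ltn_neqAle count_size andbT -all_count; apply/negP => /allP/(_ _ vs).
  by rewrite (eqP pv); case: (i).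
case: sep => sep; [apply: (Psep _ p)|apply: (Pjoin _ p)] => // u v us' vs.
all: case pu: (p u); case pv: (p v) => // _.
- by apply: sep => //; rewrite pv.
- by rewrite adj_sym; apply: sep => //; rewrite pu.
- by apply: sep => //; rewrite pv.
- by rewrite adj_sym; apply: sep => //; rewrite pu.
Qed.

End Subgroups.

(** * Laws in the groups of cographs *)

Lemma not_or3 (A B C : Prop) : ~ [\/ A, B | C] -> [/\ ~ A, ~ B & ~ C].
Proof.
by move=> n; split=> ?; apply: n; [constructor 1|constructor 2|constructor 3].
Qed.

Section Laws.
Context (G : graph).
Hypothesis finG : finite_graph G.
Implicit Types (s p : pred G) (x y z t a b c d : raag G).

Lemma commuteJ x y g : commute x y -> commute (x ^ g) (y ^ g).
Proof. by rewrite /commute -!conjMg => ->. Qed.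

Lemma commuteJ_inj x y g : commute (x ^ g) (y ^ g) -> commute x y.
Proof. by rewrite /commute -!conjMg => /conjg_inj. Qed.

Lemma small_commute s x y : (forall u v, s u -> s v -> u = v) ->
  in_sub s x -> in_sub s y -> commute x y.
Proof.
by move=> s1; apply: commute_sub => u v su sv; rewrite (s1 u v) // eqxx.
Qed.

Lemma restr_commute s x y : commute x y -> commute (restr s x) (restr s y).
Proof. exact: gmulf_commute. Qed.

Lemma vert_centralizer s p i g x y : separated_on s p -> in_sub s g ->
  x != 1 -> in_sub (side s p i) (x ^ g) -> in_sub s y -> commute x y ->
  in_sub (side s p i) (y ^ g).
Proof.
move=> sep sg x1 ix sy xy.
apply: (centralizer_elliptic sep _ ix); rewrite ?conjg_eq1 ?in_subJ //.
exact: commuteJ.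
Qed.

(** In a free product, either the centralizer of [b] is abelian and [a], [c] commute, or one
    conjugator brings [b], then [a] and [c], then [d] into the same factor. The last two moves need
    [b] and [c] nontrivial. *)
Lemma P4_law a b c d : ~ has_P4 G -> commute a b -> commute b c -> commute c d ->
  [~ [~ a, c], [~ b, d]] = 1.
Proof.
move=> P4f; suff: forall a b c d, in_sub xpredT a -> in_sub xpredT b ->
    in_sub xpredT c -> in_sub xpredT d -> commute a b -> commute b c ->
    commute c d -> [~ [~ a, c], [~ b, d]] = 1.
  by apply; apply: in_subT.
apply: (@cograph_ind G (fun s => forall a b c d, in_sub s a -> in_sub s b ->
    in_sub s c -> in_sub s d -> commute a b -> commute b c ->
    commute c d -> [~ [~ a, c], [~ b, d]] = 1)) => //.
- exact: not_P4_free_on.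
- move=> s s1 {}a {}b {}c {}d sa sb sc sd _ _ _.
  have /commgP/eqP-> := small_commute s1 sa sc; exact: comm1g.
- move=> s p _ _ sep IH {}a {}b {}c {}d sa sb sc sd ab bc cd.
  have [->|b1] := eqVneq b 1; first by rewrite comm1g commg1.
  have [->|c1] := eqVneq c 1; first by rewrite commg1 comm1g.
  have [[g sg [i ib]]|hyp] := centralizer_free_product sep sb b1; last first.
    have [/commgP/eqP-> _] := hyp a c sa sc (commute_sym ab) bc; exact: comm1g.
  have ic := vert_centralizer sep sg b1 ib sc bc.
  apply/eqP; rewrite -(conjg_eq1 _ g) !conjRg; apply/eqP; apply: (IH i) => //;
    try exact: commuteJ.
    exact: (vert_centralizer sep sg b1 ib sa (commute_sym ab)).
  exact: (vert_centralizer sep sg c1 ic sd cd).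
- move=> s p _ _ join IH {}a {}b {}c {}d sa sb sc sd ab bc cd.
  apply: (join_eq1 join); rewrite ?in_subR // => i; rewrite !gmulfR.
  by apply: (IH i); rewrite ?in_sub_restr //; apply: restr_commute.
Qed.

(** Conjugates of generators are always conjugate into a factor of a free product. In a direct
    product, elements of different factors commute, so three failing commutations place all four
    vertices in one factor. *)
Lemma P4_vert a b c d : ~ has_P4 G ->
  vert xpredT a -> vert xpredT b -> vert xpredT c -> vert xpredT d ->
  commute a b -> commute b c -> commute c d ->
  [\/ commute a c, commute b d | commute a d].
Proof.
move=> P4f; move: a b c d.
apply: (@cograph_ind G (fun s => forall a b c d, vert s a -> vert s b ->
    vert s c -> vert s d -> commute a b -> commute b c ->
    commute c d -> [\/ commute a c, commute b d | commute a d])) => //.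
- exact: not_P4_free_on.
- move=> s s1 a b c d sa sb sc sd _ _ _; constructor 1.
  by apply: (small_commute s1); apply: vert_in_sub.
- move=> s p _ _ sep IH a b c d sa sb sc sd ab bc cd.
  have [g sg [i ib]] := vert_elliptic p sb.
  have [b1 c1] := (vert_neq1 sb, vert_neq1 sc).
  have ic := vert_centralizer sep sg b1 ib (vert_in_sub sc) bc.
  have ia := vert_centralizer sep sg b1 ib (vert_in_sub sa) (commute_sym ab).
  have id := vert_centralizer sep sg c1 ic (vert_in_sub sd) cd.
  case: (IH i (a ^ g) (b ^ g) (c ^ g) (d ^ g));
    try (by apply: commuteJ); try (by apply: vert_side => //; apply: vertJ).
  + by move/commuteJ_inj; constructor 1.
  + by move/commuteJ_inj; constructor 2.
  + by move/commuteJ_inj; constructor 3.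
- move=> s p _ _ join IH a b c d sa sb sc sd ab bc cd.
  have [[[[i ia] [j jb]] [k kc]] [l ld]] := (vert_join join sa, vert_join join sb,
    vert_join join sc, vert_join join sd).
  apply: contrapT => /not_or3[ac bd ad].
  have E1 := vert_join_same join ia kc ac; have E2 := vert_join_same join jb ld bd.
  have E3 := vert_join_same join ia ld ad.
  rewrite -E1 E3 in kc; rewrite E3 in ia; rewrite E2 in jb.
  by case: (IH l a b c d).
Qed.

(** Without [P3] a join is a complete graph, as two vertices of one factor have a common neighbour
    in the other; its group is abelian. *)
Lemma commute_trans_P3 s0 : (forall u v w, s0 u -> s0 v -> s0 w ->
    adj u v -> adj v w -> u != w -> adj u w) ->
  forall a b c, in_sub s0 a -> in_sub s0 b -> in_sub s0 c -> b != 1 ->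
  commute a b -> commute b c -> commute a c.
Proof.
move=> P3f.
apply: (@cograph_ind G (fun s => forall a b c, in_sub s a -> in_sub s b ->
   in_sub s c -> b != 1 -> commute a b -> commute b c -> commute a c)) => //.
- move=> u v w z su sv sw _ uv vw wz; have [uw|uw] := eqVneq u w.
    by rewrite uw wz !orbT.
  by rewrite (P3f u v w).
- by move=> s s1 a b c sa _ sc _ _ _; apply: (small_commute s1).
- move=> s p _ _ sep IH a b c sa sb sc b1 ab bc.
  have [[g sg [i ib]]|hyp] := centralizer_free_product sep sb b1; last first.
    by have [] := hyp a c sa sc (commute_sym ab) bc.
  apply: (@commuteJ_inj _ _ g); apply: (IH i _ (b ^ g)); rewrite ?conjg_eq1 //;
    try exact: commuteJ.
    exact: (vert_centralizer sep sg b1 ib sa (commute_sym ab)).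
  exact: (vert_centralizer sep sg b1 ib sc bc).
- move=> s p ss0 hs join _ a b c sa _ sc _ _ _.
  apply: commute_sub sa sc => u v su sv uv.
  have [puv|puv] := eqVneq (p u) (p v); last exact: join.
  have [w /andP[sw /eqP pw]] := hs (~~ p u).
  have uw : adj u w by apply: join => //; rewrite pw; case: (p u).
  have wv : adj w v by apply: join => //; rewrite pw -puv; case: (p u).
  by apply: (P3f u w v) => //; apply: ss0.
Qed.

(** A [P3] is connected, hence on one side, and any vertex of the other side completes it to
    [P3 + P1]. *)
Lemma not_P3_P3P1 s p : ~ has_P3P1 G -> (forall i, exists v, side s p i v) ->
  separated_on s p -> forall u v w, s u -> s v -> s w ->
    adj u v -> adj v w -> u != w -> adj u w.
Proof.
move=> P3P1f hs sep u v w su sv sw uv vw uw; apply/negPn/negP => nuw.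
have same (x y : G) : s x -> s y -> adj x y -> p x = p y.
  by move=> sx sy xy; apply/eqP/negPn/negP => /(sep _ _ sx sy); rewrite xy.
have [t /andP[st /eqP pt]] := hs (~~ p u).
have tn (x : G) : s x -> p x = p u -> ~~ adj t x.
  by move=> sx px; apply: sep => //; rewrite pt px; case: (p u).
apply: P3P1f; exists u, v, w, t; split; [by split| exact: tn | |].
  by apply: tn => //; rewrite -(same u v).
by apply: tn => //; rewrite -(same v w) // -(same u v).
Qed.

(** At a disjoint union no [P3] is left, so [y] or [[~ x, z]] is trivial. Conjugation by [t] gives
    the law its content, since [y] itself commutes with [[~ x, z]] in any group. *)
Lemma P3P1_law x y z t : ~ has_P4 G -> ~ has_P3P1 G -> commute x y -> commute y z ->
  [~ [~ x, z], y ^ t] = 1.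
Proof.
move=> P4f P3P1f; suff: forall x y z t, in_sub xpredT x -> in_sub xpredT y ->
    in_sub xpredT z -> in_sub xpredT t -> commute x y -> commute y z ->
    [~ [~ x, z], y ^ t] = 1.
  by apply; apply: in_subT.
apply: (@cograph_ind G (fun s => forall x y z t, in_sub s x -> in_sub s y ->
    in_sub s z -> in_sub s t -> commute x y -> commute y z ->
    [~ [~ x, z], y ^ t] = 1)) => //.
- exact: not_P4_free_on.
- move=> s s1 {}x {}y {}z {}t sx sy sz st _ _.
  have /commgP/eqP-> := small_commute s1 sx sz; exact: comm1g.
- move=> s p _ hs sep _ {}x {}y {}z {}t sx sy sz st xy yz.
  have [->|y1] := eqVneq y 1; first by rewrite conj1g commg1.
  have P3f := not_P3_P3P1 P3P1f hs sep.
  have /commgP/eqP-> := commute_trans_P3 P3f sx sy sz y1 xy yz; exact: comm1g.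
- move=> s p _ _ join IH {}x {}y {}z {}t sx sy sz st xy yz.
  apply: (join_eq1 join); rewrite ?in_subR ?in_subJ // => i; rewrite !gmulfR gmulfJ.
  by apply: (IH i); rewrite ?in_sub_restr //; apply: restr_commute.
Qed.

Lemma P3P1_vert x y z t : ~ has_P4 G -> ~ has_P3P1 G ->
  vert xpredT x -> vert xpredT y -> vert xpredT z -> vert xpredT t ->
  commute x y -> commute y z ->
  commute x z \/ [\/ commute t x, commute t y | commute t z].
Proof.
move=> P4f P3P1f; move: x y z t.
apply: (@cograph_ind G (fun s => forall x y z t, vert s x -> vert s y ->
    vert s z -> vert s t -> commute x y -> commute y z ->
    commute x z \/ [\/ commute t x, commute t y | commute t z])) => //.
- exact: not_P4_free_on.
- move=> s s1 x y z t sx _ sz _ _ _; left.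
  by apply: (small_commute s1); apply: vert_in_sub.
- move=> s p _ hs sep _ x y z t sx sy sz st xy yz; left.
  have P3f := not_P3_P3P1 P3P1f hs sep.
  exact: (commute_trans_P3 P3f (vert_in_sub sx) (vert_in_sub sy) (vert_in_sub sz)
    (vert_neq1 sy)).
- move=> s p _ _ join IH x y z t sx sy sz st xy yz.
  have [[[[i ix] [j jy]] [k kz]] [l lt]] := (vert_join join sx, vert_join join sy,
    vert_join join sz, vert_join join st).
  apply: contrapT => /not_orP[nxz /not_or3[tx ty tz]].
  have E1 := vert_join_same join lt ix tx; have E2 := vert_join_same join lt jy ty.
  have E3 := vert_join_same join lt kz tz.
  rewrite -E1 in ix; rewrite -E2 in jy; rewrite -E3 in kz.
  by case: (IH l x y z t) => // -[].
Qed.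

(** The group is free: it is cyclic in the base case, a separated splitting leads to a factor or to
    [centralizer_free_product], and a joined one would contain an edge. *)
Lemma edgeless_root s0 : (forall u v, s0 u -> s0 v -> ~~ adj u v) ->
  forall x y, in_sub s0 x -> in_sub s0 y -> commute x y -> x != 1 ->
  exists m n, 0 < m /\ (y ^+ m = x ^+ n \/ y ^+ m = x ^- n).
Proof.
move=> P2f.
apply: (@cograph_ind G (fun s => forall x y, in_sub s x -> in_sub s y ->
  commute x y -> x != 1 ->
  exists m n, 0 < m /\ (y ^+ m = x ^+ n \/ y ^+ m = x ^- n))) => //.
- by move=> u v w z su sv _ _ uv; have := P2f u v su sv; rewrite uv.
- move=> s s1 x y sx sy _ x1.
  have pow z : in_sub s z -> z = 1 \/
      exists v n, s v /\ (z = raag_gen v ^+ n \/ z = raag_gen v ^- n).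
    elim/in_sub_ind => [|v {}z sv _ IH|v {}z sv _ IH]; first by left.
      right; case: IH => [->|[w [n [sw E]]]].
        by exists v, 1%N; split=> //; left; rewrite mulg1.
      rewrite (s1 w v) // in E; case: E => ->.
        by exists v, n.+1; split=> //; left; rewrite expgS.
      case: n => [|n].
        by exists v, 1%N; split=> //; left; rewrite expg0 invg1 mulg1.
      by exists v, n; split=> //; right; rewrite expgSr invgM mulVKg.
    right; case: IH => [->|[w [n [sw E]]]].
      by exists v, 1%N; split=> //; right; rewrite mulg1.
    rewrite (s1 w v) // in E; case: E => ->.
      case: n => [|n].
        by exists v, 1%N; split=> //; right; rewrite expg0 mulg1.
      by exists v, n; split=> //; left; rewrite expgS mulKg.
    by exists v, n.+1; split=> //; right; rewrite expgSr invgM.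
  case: (pow _ sx) => [E|[v [n [sv xE]]]]; first by rewrite E eqxx in x1.
  have n0 : 0 < n.
    by case: n xE => // -[] E; rewrite E ?expg0 ?invg1 eqxx in x1.
  case: (pow _ sy) => [->|[w [k [sw yE]]]].
    by exists 1%N, 0; split=> //; left.
  rewrite (s1 w v) // in yE; exists n, k; split=> //.
  case: xE yE => -> [] ->; rewrite ?expVgn -!expgnA mulnC ?invgK; by [left|right].
- move=> s p _ _ sep IH x y sx sy xy x1.
  have [[g sg [i ix]]|hyp] := centralizer_free_product sep sx x1; last first.
    by have [] := hyp y y sy sy xy xy.
  have [||||m [n [m0 E]]] := IH i (x ^ g) (y ^ g) => //; first 2 last.
  + by rewrite conjg_eq1.
  + exists m, n; split=> //; move: E; rewrite -!conjXg -conjVg.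
    by case=> /conjg_inj; [left|right].
  + exact: (vert_centralizer sep sg x1 ix sy xy).
  + exact: commuteJ.
- move=> s p ss0 hs join _ x y.
  have [u /andP[su /eqP pu]] := hs true; have [v /andP[sv /eqP pv]] := hs false.
  have := P2f u v (ss0 _ su) (ss0 _ sv); rewrite join // pu pv //.
Qed.

Lemma edgeless_vert s0 : (forall u v, s0 u -> s0 v -> ~~ adj u v) ->
  forall x y, vert s0 x -> vert s0 y -> commute x y -> x = y.
Proof.
move=> P2f.
apply: (@cograph_ind G (fun s => forall x y, vert s x -> vert s y ->
  commute x y -> x = y)) => //.
- by move=> u v w z su sv _ _ uv; have := P2f u v su sv; rewrite uv.
- move=> s s1 x y [u [g [su sg ->]]] [v [h [sv sh ->]]] _.
  have fixJ w k : s w -> in_sub s k -> raag_gen w ^ k = raag_gen w.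
    move=> sw sk; apply/conjg_fixP/commgP.
    by apply: (small_commute s1) => //; apply: in_sub_gen.
  by rewrite !fixJ // (s1 u v).
- move=> s p _ _ sep IH x y vx vy xy.
  have [g sg [i ix]] := vert_elliptic p vx.
  apply: (@conjg_inj _ g); apply: (IH i); last exact: commuteJ.
    by apply: vert_side => //; apply: vertJ.
  apply: vert_side; first exact: vertJ.
  exact: (vert_centralizer sep sg (vert_neq1 vx) ix (vert_in_sub vy) xy).
- move=> s p ss0 hs join _ x y.
  have [u /andP[su /eqP pu]] := hs true; have [v /andP[sv /eqP pv]] := hs false.
  have := P2f u v (ss0 _ su) (ss0 _ sv); rewrite join // pu pv //.
Qed.

Lemma not_P2_P2P1 s p : ~ has_P2P1 G -> (forall i, exists v, side s p i v) ->
  separated_on s p -> forall u v, s u -> s v -> ~~ adj u v.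
Proof.
move=> P2P1f hs sep u v su sv; apply/negP => uv.
have same : p u = p v.
  by apply/eqP/negPn/negP => /(sep _ _ su sv); rewrite uv.
have [t /andP[st /eqP pt]] := hs (~~ p u).
apply: P2P1f; exists u, v, t.
by split=> //; apply: sep => //; rewrite pt -?same; case: (p u).
Qed.

Lemma P2P1_vert x y t : ~ has_P4 G -> ~ has_P2P1 G ->
  vert xpredT x -> vert xpredT y -> vert xpredT t -> commute x y ->
  [\/ x = y, commute t x | commute t y].
Proof.
move=> P4f P2P1f; move: x y t.
apply: (@cograph_ind G (fun s => forall x y t, vert s x -> vert s y ->
    vert s t -> commute x y -> [\/ x = y, commute t x | commute t y])) => //.
- exact: not_P4_free_on.
- move=> s s1 x y t sx _ st _; constructor 2.
  by apply: (small_commute s1); apply: vert_in_sub.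
- move=> s p _ hs sep _ x y t sx sy _ xy; constructor 1.
  exact: (edgeless_vert (not_P2_P2P1 P2P1f hs sep)).
- move=> s p _ _ join IH x y t sx sy st xy.
  have [[[i ix] [j jy]] [l lt]] :=
    (vert_join join sx, vert_join join sy, vert_join join st).
  apply: contrapT => /not_or3[nxy tx ty].
  have E1 := vert_join_same join lt ix tx; have E2 := vert_join_same join lt jy ty.
  rewrite -E1 in ix; rewrite -E2 in jy.
  by case: (IH l x y t).
Qed.

Definition combo x y (q : bool * nat * nat) : raag G :=
  let: (e, m, n) := q in x ^+ m * (if e then y ^+ n else y ^- n).

Definition iter_comm x y (L : seq (bool * nat * nat)) t : raag G :=
  foldl (fun t q => [~ t, combo x y q]) t L.

Lemma iter_comm_restr s x y L t :
  restr s (iter_comm x y L t) = iter_comm (restr s x) (restr s y) L (restr s t).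
Proof.
rewrite /iter_comm; elim: L t => //= [[[e m] n] L] IHL t.
rewrite IHL gmulfR; congr (foldl _ [~ _, _] _).
by rewrite /combo gmulfM gmulfXn; case: e; rewrite ?gmulfV gmulfXn.
Qed.

Lemma in_sub_iter_comm s x y L t : in_sub s x -> in_sub s y -> in_sub s t ->
  in_sub s (iter_comm x y L t).
Proof.
by move=> /eqP sx /eqP sy /eqP st; rewrite /in_sub iter_comm_restr sx sy st.
Qed.

Lemma iter_comm1 x y L : iter_comm x y L 1 = 1.
Proof. by rewrite /iter_comm; elim: L => //= q L; rewrite comm1g. Qed.

(* In each join factor, which is free, [x] and [y] satisfy a relation
   [x ^ m * y ^ (+- n) = 1]; the iterated commutator collects all of them. *)
Lemma P2P1_law x y : ~ has_P4 G -> ~ has_P2P1 G -> commute x y ->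
  exists2 L, all (fun q => 0 < q.1.2 + q.2) L &
    forall t, iter_comm x y L t = 1.
Proof.
move=> P4f P2P1f; suff: forall x y, in_sub xpredT x -> in_sub xpredT y ->
    commute x y -> exists2 L, all (fun q => 0 < q.1.2 + q.2) L &
    forall t, in_sub xpredT t -> iter_comm x y L t = 1.
  move=> H xy; have [||L L0 E] := H x y _ _ xy; rewrite ?in_subT //.
  by exists L => // t; rewrite E ?in_subT.
have edgeless s : (forall u v, s u -> s v -> ~~ adj u v) ->
    forall x y, in_sub s x -> in_sub s y ->
    commute x y -> exists2 L, all (fun q => 0 < q.1.2 + q.2) L &
    forall t, in_sub s t -> iter_comm x y L t = 1.
  move=> P2f {}x {}y sx sy xy.
  have [->|x1] := eqVneq x 1.
    by exists [:: (true, 1%N, 0)] => // t _; rewrite /iter_comm /= /combo mul1g commg1.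
  have [m [n [m0 E]]] := edgeless_root P2f sx sy xy x1.
  case: E => E.
    exists [:: (false, n, m)] => [|t _]; first by rewrite /= addn_gt0 m0 orbT.
    by rewrite /iter_comm /= /combo E mulgV commg1.
  exists [:: (true, n, m)] => [|t _]; first by rewrite /= addn_gt0 m0 orbT.
  by rewrite /iter_comm /= /combo E mulgV commg1.
apply: (@cograph_ind G (fun s => forall x y, in_sub s x -> in_sub s y ->
    commute x y -> exists2 L, all (fun q => 0 < q.1.2 + q.2) L &
    forall t, in_sub s t -> iter_comm x y L t = 1)) => //.
- exact: not_P4_free_on.
- move=> s s1; apply: edgeless => u v su sv.
  by rewrite (s1 u v) // adj_irr.
- by move=> s p _ hs sep _; apply: edgeless; apply: not_P2_P2P1 sep.
- move=> s p _ _ join IH {}x {}y sx sy xy.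
  pose r i := restr (side s p i).
  have rx i z : in_sub (side s p i) (r i z) by apply: in_sub_restr.
  have [L L0 LE] := IH true (r true x) (r true y) (rx _ _) (rx _ _)
    (restr_commute _ xy).
  have [M M0 ME] := IH false (r false x) (r false y) (rx _ _) (rx _ _)
    (restr_commute _ xy).
  (* The commutators from [L] kill the component in one factor, those from [M] the component in the
     other; a trivial component stays trivial. *)
  exists (L ++ M) => [|t st]; first by rewrite all_cat L0 M0.
  have cat u v w : iter_comm u v (L ++ M) w = iter_comm u v M (iter_comm u v L w).
    by rewrite /iter_comm foldl_cat.
  apply: (join_eq1 join).
    exact: in_sub_iter_comm.
  case; rewrite iter_comm_restr cat.
    by rewrite LE ?iter_comm1 //; apply: in_sub_restr.
  by apply: ME; apply: in_sub_iter_comm; apply: in_sub_restr.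
Qed.

End Laws.

(** * The laws fail for the forbidden graphs *)

Definition swap_pts (i j k : nat) : nat :=
  if k == i then j else if k == j then i else k.

Lemma swap_ptsK i j : involutive (swap_pts i j).
Proof.
move=> k; rewrite /swap_pts; case: (eqVneq k i) => [->|ki].
  by rewrite eqxx; case: eqP.
by case: (eqVneq k j) => [->|kj]; rewrite ?eqxx // (negbTE ki) (negbTE kj).
Qed.

Section Witnesses.
Context (G : graph).
Implicit Types (a b c d u v w : G).

Lemma raag_involution_act (T : Type) (f : G -> T -> T) :
  (forall v, involutive (f v)) ->
  (forall v w, adj v w -> forall t, f v (f w t) = f w (f v t)) ->
  exists act : raag G -> T -> T,
  [/\ act 1 =1 id, forall x y t, act (x * y) t = act x (act y t),
      forall v, act (raag_gen v) =1 f v & forall v, act (raag_gen v)^-1 =1 f v].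
Proof.
move=> fK fC; have [act [a1 aM ag]] := raag_act_ex fK fK fC.
exists act; split=> // v t.
by rewrite -{1}[t](fK v) -ag -aM mulVg a1.
Qed.

Lemma raag_gen_pow_neq u v m n : u != v -> 0 < m ->
  raag_gen v ^+ m <> raag_gen u ^+ n /\ raag_gen v ^+ m <> raag_gen u ^- n.
Proof.
move=> uv m0; have [f fM fg] := exponent_ex v.
have f1 : f 1 = 0%R by apply: (GRing.addrI (f 1)); rewrite -fM mulg1 GRing.addr0.
have fX x k : f (x ^+ k) = (f x *+ k)%R.
  by elim: k => [|k IHk]; rewrite ?expg0 // expgS fM IHk GRing.mulrS.
have fv : f (raag_gen v ^+ m) <> 0%R by rewrite fX fg eqxx; lia.
have fu : f (raag_gen u ^+ n) = 0%R by rewrite fX fg (negbTE uv) GRing.mul0rn.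
split=> E; first by rewrite E in fv.
apply: fv; rewrite E.
by have := fM (raag_gen u ^- n) (raag_gen u ^+ n); rewrite mulVg f1 fu GRing.addr0.
Qed.

Lemma raag_gen_inj : injective (@raag_gen G).
Proof.
move=> u v E; apply/eqP/contraT => uv.
by have [] := @raag_gen_pow_neq u v 1 1 uv isT; rewrite !expg1 E.
Qed.

(** Distinct nonadjacent [u] and [v] can act as the transpositions (0 1) and (1 2), which do not
    commute, the other generators acting trivially. *)
Lemma raag_commuteE u v : commute (raag_gen u) (raag_gen v) -> u = v \/ adj u v.
Proof.
move=> uv; have [->|nuv] := eqVneq u v; first by left.
right; apply/negPn/negP => nadj.
pose f w := if w == u then swap_pts 0 1 else if w == v then swap_pts 1 2 else id.
have [||a [a1 aM ag _]] := @raag_involution_act nat f.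
- by move=> w; rewrite /f; do ![case: ifP => _ //]; apply: swap_ptsK.
- move=> w w' ww' k; rewrite /f.
  case: (eqVneq w u) ww' => [->|_]; last case: (eqVneq w v) => [->|_] //;
  case: (eqVneq w' u) => [->|_]; rewrite ?adj_irr //; try
  case: (eqVneq w' v) => [->|_] //; rewrite ?adj_irr ?(negbTE nadj) //.
  by rewrite adj_sym (negbTE nadj).
have := congr1 (a^~ 0) uv; rewrite /= !aM !ag /f eqxx eq_sym (negbTE nuv) eqxx.
by [].
Qed.

(** The transpositions (0 1), (3 4), (1 2), (0 3) for [a], [b], [c], [d] are disjoint along edges.
    The two inner commutators are 3-cycles whose supports share the point 0 only, so they do not
    commute. *)
Lemma P4_law_witness a b c d : adj a b -> adj b c -> adj c d ->
  ~~ adj a c -> ~~ adj b d -> ~~ adj a d ->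
  [~ [~ raag_gen a, raag_gen c], [~ raag_gen b, raag_gen d]] != 1.
Proof.
move=> ab bc cd ac bd ad.
pose f w := if w == a then swap_pts 0 1 else if w == b then swap_pts 3 4 else
  if w == c then swap_pts 1 2 else if w == d then swap_pts 0 3 else id.
have [||act [a1 aM ag agV]] := @raag_involution_act nat f.
- by move=> w; rewrite /f; do ![case: ifP => _ //]; apply: swap_ptsK.
- move=> w w' ww' k; move: ww'; rewrite /f.
  case: (eqVneq w a) => [->|_]; last case: (eqVneq w b) => [->|_];
    last case: (eqVneq w c) => [->|_]; last case: (eqVneq w d) => [->|_] //;
  (case: (eqVneq w' a) => [->|_]; last case: (eqVneq w' b) => [->|_];
    last case: (eqVneq w' c) => [->|_]; last case: (eqVneq w' d) => [->|_] //);
  rewrite ?adj_irr ?[adj _ a]adj_sym ?[adj c b]adj_sym ?[adj d _]adj_sym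
    ?(negbTE ac) ?(negbTE bd) ?(negbTE ad) // => _;
  by do 5 case: k => [//|k].
apply/eqP => E.
have nab : (a == b) = false by apply: contraTF ab => /eqP->; rewrite adj_irr.
have nbc : (b == c) = false by apply: contraTF bc => /eqP->; rewrite adj_irr.
have ncd : (c == d) = false by apply: contraTF cd => /eqP->; rewrite adj_irr.
have nac : (a == c) = false by apply: contraTF cd => /eqP<-.
have nbd : (b == d) = false by apply: contraTF ab => /eqP->.
have nad : (a == d) = false by apply: contraTF ab => /eqP->; rewrite adj_sym.
have F k : act [~ [~ raag_gen a, raag_gen c], [~ raag_gen b, raag_gen d]] k = k.
  by rewrite E a1.
have fa : f a = swap_pts 0 1 by rewrite /f eqxx.
have fb : f b = swap_pts 3 4 by rewrite /f eq_sym nab eqxx.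
have fc : f c = swap_pts 1 2 by rewrite /f ![c == _]eq_sym nac nbc eqxx.
have fd : f d = swap_pts 0 3 by rewrite /f ![d == _]eq_sym nad nbd ncd eqxx.
have := (F 0, F 1%N, F 2, F 3, F 4).
rewrite !commgEl !conjgE !invgM !invgK !aM !ag !agV fa fb fc fd.
by case.
Qed.

(** With (1 2), (3 4), (0 1), (2 3) for [a], [b], [c], [d], the inner commutator is a 3-cycle on 0,
    1, 2 and the conjugate of [b] is (2 4); their supports share one point. *)
Lemma P3P1_law_witness a b c d : adj a b -> adj b c -> a != c -> ~~ adj a c ->
  ~~ adj d a -> ~~ adj d b -> ~~ adj d c ->
  [~ [~ raag_gen a, raag_gen c], raag_gen b ^ raag_gen d] != 1.
Proof.
move=> ab bc nac ac da db dc.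
pose f w := if w == a then swap_pts 1 2 else if w == b then swap_pts 3 4 else
  if w == c then swap_pts 0 1 else if w == d then swap_pts 2 3 else id.
have [||act [a1 aM ag agV]] := @raag_involution_act nat f.
- by move=> w; rewrite /f; do ![case: ifP => _ //]; apply: swap_ptsK.
- move=> w w' ww' k; move: ww'; rewrite /f.
  case: (eqVneq w a) => [->|_]; last case: (eqVneq w b) => [->|_];
    last case: (eqVneq w c) => [->|_]; last case: (eqVneq w d) => [->|_] //;
  (case: (eqVneq w' a) => [->|_]; last case: (eqVneq w' b) => [->|_];
    last case: (eqVneq w' c) => [->|_]; last case: (eqVneq w' d) => [->|_] //);
  rewrite ?adj_irr ?[adj c a]adj_sym ?[adj _ d]adj_sym
    ?(negbTE ac) ?(negbTE da) ?(negbTE db) ?(negbTE dc) // => _;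
  by do 5 case: k => [//|k].
apply/eqP => E.
have nab : (a == b) = false by apply: contraTF ab => /eqP->; rewrite adj_irr.
have nbc : (b == c) = false by apply: contraTF bc => /eqP->; rewrite adj_irr.
have nad : (a == d) = false by apply: contraTF ab => /eqP->.
have nbd : (b == d) = false by apply: contraTF bc => /eqP->.
have ncd : (c == d) = false by apply: contraTF bc => /eqP->; rewrite adj_sym.
have F k : act [~ [~ raag_gen a, raag_gen c], raag_gen b ^ raag_gen d] k = k.
  by rewrite E a1.
have fa : f a = swap_pts 1 2 by rewrite /f eqxx.
have fb : f b = swap_pts 3 4 by rewrite /f eq_sym nab eqxx.
have fc : f c = swap_pts 0 1 by rewrite /f ![c == _]eq_sym (negbTE nac) nbc eqxx.
have fd : f d = swap_pts 2 3 by rewrite /f ![d == _]eq_sym nad nbd ncd eqxx.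
have := (F 0, F 1%N, F 2, F 3, F 4).
rewrite !commgEl !conjgE !invgM !invgK !aM !ag !agV fa fb fc fd.
by case.
Qed.

Import GRing.Theory.
Local Open Scope ring_scope.

(* The generators act on [int * int] through the matrices
   [[1, N], [0, 1]], [[1, 1], [0, 1]] and [[1, 0], [1, 1]]; the lower left
   entry of the iterated commutator stays nonzero. *)
Lemma P2P1_law_witness a b d (L : seq (bool * nat * nat)) :
  adj a b -> ~~ adj d a -> ~~ adj d b -> all (fun q => 0 < q.1.2 + q.2)%N L ->
  iter_comm (raag_gen a) (raag_gen b) L (raag_gen d) <> 1%g.
Proof.
move=> ab da db L0.
have nab : (a == b) = false by apply: contraTF ab => /eqP->; rewrite adj_irr.
have nad : (a == d) = false by apply: contraTF ab => /eqP->.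
have nbd : (b == d) = false.
  by apply: contraTF ab => /eqP->; rewrite adj_sym.
(* [N] exceeds every exponent of [b] in [L], so [N * m + n] and [N * m - n] vanish only for
   [m = n = 0]. *)
pose M := (\max_(q <- L) q.2)%N; pose N : int := Posz M.+1.
pose up (k : int) (x : int * int) := (x.1 + k * x.2, x.2).
pose f w x : int * int := if w == a then up N x else if w == b then up 1 x else
  if w == d then (x.1, x.1 + x.2) else x.
pose g w x : int * int := if w == a then up (- N) x else if w == b then up (-1) x else
  if w == d then (x.1, x.2 - x.1) else x.
have upD j k x : up j (up k x) = up (j + k) x.
  by rewrite /up /=; congr pair; ring.
have up0 x : up 0 x = x by rewrite /up mul0r addr0; case: x.
have [|||act [a1 aM ag]] := @raag_act_ex G (int * int) f g.
- move=> w [x y]; rewrite /f /g; case: (w == a); case: (w == b); case: (w == d);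
    rewrite ?upD ?addNr ?up0 //=;
  by congr pair; ring.
- move=> w [x y]; rewrite /f /g; case: (w == a); case: (w == b); case: (w == d);
    rewrite ?upD ?addrN ?up0 //=;
  by congr pair; ring.
- move=> w w' + x; rewrite /f.
  case: (eqVneq w a) => [->|_]; last case: (eqVneq w b) => [->|_];
    last case: (eqVneq w d) => [->|_] //;
  (case: (eqVneq w' a) => [->|_]; last case: (eqVneq w' b) => [->|_];
    last case: (eqVneq w' d) => [->|_] //);
  rewrite ?adj_irr ?[adj _ d]adj_sym ?(negbTE da) ?(negbTE db) // => _;
  by rewrite !upD addrC.
have actV z h : (forall x, act z (h x) = x) -> forall x, act z^-1%g x = h x.
  by move=> zh x; rewrite -{1}[x]zh -aM mulVg a1.
have actX z k n : (forall x, act z x = up k x) ->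
    forall x, act (z ^+ n)%g x = up (k *+ n) x.
  move=> zk; elim: n => [|n IHn] x; first by rewrite expg0 a1 mulr0n up0.
  by rewrite expgS aM zk IHn upD mulrS.
have actN z k : (forall x, act z x = up k x) -> forall x, act z^-1%g x = up (- k) x.
  by move=> zk; apply: actV => x; rewrite zk upD addrN up0.
have aa x : act (raag_gen a) x = up N x by rewrite ag /f eqxx.
have ab' x : act (raag_gen b) x = up 1 x by rewrite ag /f eq_sym nab eqxx.
have ad x : act (raag_gen d) x = (x.1, x.1 + x.2).
  by rewrite ag /f ![d == _]eq_sym nad nbd eqxx.
have combE q : q \in L -> exists2 k, k != 0 &
    forall x, act (combo (raag_gen a) (raag_gen b) q) x = up k x.
  case: q => [[e m] n] qL; have /= mn := allP L0 _ qL.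
  have nM : (n <= M)%N.
    exact: (@leq_bigmax_seq _ _ xpredT (fun q : bool * nat * nat => q.2) _ qL isT).
  exists (N *+ m + (if e then 1 *+ n else - (1 *+ n))).
    rewrite -[N *+ m]mulr_natr !natz -PoszM.
    have : (n < M.+1 * m)%N \/ ((M.+1 * m = 0) /\ 0 < n)%N.
      case: (posnP m) mn => [->|m0 _]; first by rewrite muln0; right.
      by left; apply: leq_ltn_trans nM _; rewrite leq_pmulr.
    by move: (M.+1 * m)%N => k; case: e {qL}; lia.
  move=> x; rewrite /combo aM (actX _ _ _ aa) -upD; congr up.
  by case: e {qL}; rewrite ?(actN _ _ (actX _ _ n ab')) ?(actX _ _ n ab').
(* Invariant: [z] acts by a matrix of determinant 1 with nonzero lower left entry, hence not as the
   identity. *)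
suff H z : (exists p q c e : int, [/\ c != 0, p * e - q * c = 1 &
    forall x, act z x = (p * x.1 + q * x.2, c * x.1 + e * x.2)]) ->
    iter_comm (raag_gen a) (raag_gen b) L z <> 1%g.
  apply: H; exists 1, 0, 1, 1; split=> // x.
  by rewrite ad !mul1r mul0r addr0.
rewrite /iter_comm.
elim: L z combE {L0 M N f g aa ab' ad ag actX} => /= [|h L IHL] z combE zP.
  have [p [q [c [e [c0 _ zE]]]]] := zP => z1; have := zE (1, 0).
  rewrite z1 a1 /= !mulr0 !addr0 !mulr1 => -[_ /esym/eqP].
  by rewrite (negbTE c0).
apply: IHL => [h' h'L|]; first by apply: combE; rewrite inE h'L orbT.
have [k k0 hE] := combE h (mem_head _ _).
have [p [q [c [e [c0 det zE]]]]] := zP.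
have zV x : act z^-1%g x = (e * x.1 - q * x.2, - c * x.1 + p * x.2).
  move: x; apply: actV => -[x y]; rewrite zE /=; congr pair.
    by rewrite -[RHS]mul1r -det; ring.
  by rewrite -[RHS]mul1r -det; ring.
(* The matrix of the commutator of [z] with a transvection by [k]; its lower left entry is
   [k * c * c]. *)
exists (e * (p - k * c) - q * c), (e * ((p - k * c) * k + (q - k * e)) - q * (c * k + e)),
  (- c * (p - k * c) + p * c), (- c * ((p - k * c) * k + (q - k * e)) + p * (c * k + e)).
split.
- have -> : - c * (p - k * c) + p * c = k * c * c by ring.
  by rewrite !mulf_neq0.
- by rewrite -[RHS]mulr1 -[in RHS]det; ring.
- move=> [x y]; rewrite commgEl conjgE !aM hE zE (actN _ _ hE) zV /up /=.
  by congr pair; ring.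
Qed.

End Witnesses.

(** * Conclusion *)

(** A path in a disjoint union stays in its first component, so a cycle lifts to one of the
    trees. *)
Lemma forest_acyclic (G : graph) : forest G -> acyclic_graph G.
Proof.
move=> [I [T [Tt [f [g fK gK] fA]]]] c c2 /andP[cc uc].
have comp i (y : T i) p : path (@adj (disjoint_union T)) (Tagged T y) p ->
    exists2 p', p = map (fun z : T i => Tagged T z) p' & path adj y p'.
  elim: p y => [|z p IHp] y /=; first by exists [::].
  case/andP; rewrite {1}/adj /= => /andP[/eqP iz yz].
  case: z iz yz => j z /= ij; case: j / ij z => z; rewrite tagged_asE => yz.
  by case/IHp=> p' -> zp'; exists (z :: p') => //; apply/andP.
case: c c2 cc uc => // x c c2 cc uc.
have : path (@adj (disjoint_union T)) (f x) (rcons (map f c) (f x)).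
  by rewrite -map_rcons path_map; apply: sub_path cc => u v; rewrite -fA.
case E: (f x) => [i y]; rewrite -[existT _ _ _]/(Tagged T y) => /comp[p' pE yp'].
case/lastP: p' pE yp' => [|p' w]; first by case: (c).
rewrite map_rcons => /rcons_inj[cE /eqP]; rewrite eq_Tagged /= => /eqP<- yp'.
have [_ _ acT] := Tt i; apply: (acT (y :: p')).
  by move: c2; rewrite /= -(size_map f) cE size_map.
apply/andP; split=> //; apply: (@map_uniq _ _ (fun z : T i => Tagged T z)).
have <- : map f (x :: c) = map (fun z : T i => Tagged T z) (y :: p').
  by rewrite /= E cE.
by rewrite map_inj_uniq //; apply: can_inj fK.
Qed.

Section Main.
Context (L G : graph).

(** An injective homomorphism preserves and reflects commutation, and commuting generators are equal
    or adjacent. *)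
Lemma strong_emb_ext : strong_emb L G ->
  exists A : pred (ext_graph G), graph_iso L (induced A).
Proof.
move=> [f [fI fg]].
have fV v : ext_vertex (f (raag_gen v)).
  by apply/asboolP; have [u [x ->]] := fg v; exists u, x.
pose h v : ext_graph G := Sub (f (raag_gen v)) (fV v).
have hI : injective h by move=> v w [/fI/raag_gen_inj].
pose A : pred (ext_graph G) := fun y => `[< exists v, h v = y >].
have hA v : A (h v) by apply/asboolP; exists v.
pose k v : induced A := Sub (h v) (hA v).
exists A, k.
  have kS y : exists v, k v = y.
    by case: y => y Ay; have /asboolP[v E] := Ay; exists v; apply: val_inj.
  exists (fun y => projT1 (cid (kS y))) => [v|y].
    by case: cid => w /= [/fI/raag_gen_inj].
  by case: cid.
move=> v w; rewrite [LHS]/adj /=.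
apply/andP/idP => [[vw /asboolP C]|vw].
  have {C} : commute (raag_gen v) (raag_gen w) by apply: fI; rewrite !gmulfM.
  by case/raag_commuteE => // E; rewrite E eqxx in vw.
split; last by apply/asboolP; rewrite /commute -!gmulfM raag_commute.
by apply/eqP => /fI/raag_gen_inj E; rewrite E adj_irr in vw.
Qed.

(** Either side of the equivalence, so that every obstruction serves both directions. *)
Definition realized : Prop :=
  (exists f : UMagmaMorphism.type (raag L) (raag G), injective f) \/
  (exists phi : L -> raag G, [/\ injective phi, forall v, vert xpredT (phi v) &
    forall v w, adj v w <-> v <> w /\ commute (phi v) (phi w)]).

Lemma ext_realized :
  (exists A : pred (ext_graph G), graph_iso L (induced A)) -> realized.
Proof.
move=> [A [h [g hK gK] hA]]; right.
exists (fun v => val (val (h v))); split.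
- by move=> v w /val_inj/val_inj/(can_inj hK).
- move=> v; have /asboolP[u [x ->]] := valP (val (h v)).
  by exists u, x; rewrite in_subT.
- move=> v w; rewrite -hA /adj /= /adj /=; split=> [/andP[vw /asboolP C]|[vw C]].
    by split=> // E; rewrite E eqxx in vw.
  rewrite (asboolT C) andbT; apply/eqP => /val_inj/val_inj/(can_inj hK).
  exact: vw.
Qed.

Hypotheses (finG : finite_graph G) (HR : realized).

Let hom_commute (f : UMagmaMorphism.type (raag L) (raag G)) v w :
  adj v w -> commute (f (raag_gen v)) (f (raag_gen w)).
Proof. by move=> vw; apply/gmulf_commute/raag_commute. Qed.

Let hom_noncommute (f : UMagmaMorphism.type (raag L) (raag G)) v w : injective f ->
  v != w -> ~~ adj v w -> ~ commute (f (raag_gen v)) (f (raag_gen w)).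
Proof.
move=> fI vw nvw C.
have : commute (raag_gen v) (raag_gen w) by apply: fI; rewrite !gmulfM.
by case/raag_commuteE => [E|E]; [rewrite E eqxx in vw|rewrite E in nvw].
Qed.

Let adj_neq (v w : L) : adj v w -> v != w.
Proof. by apply: contraTneq => ->; rewrite adj_irr. Qed.

(** An embedding of groups is refuted by the law and its witness, an induced subgraph by the
    parallel statement on [vert]. The next lemmas follow the same pattern. *)
Lemma realized_P4 : has_P4 L -> has_P4 G.
Proof.
move=> [a [b [c [d [ab bc cd [ac bd ad]]]]]]; apply: contrapT => P4f.
case: HR => [[f fI]|[phi [phiI phiV phiA]]].
  have /eqP := P4_law_witness ab bc cd ac bd ad; apply; apply: fI.
  rewrite gmulf1 !gmulfR; apply: P4_law => //; exact: hom_commute.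
have C v w : adj v w -> commute (phi v) (phi w) by case/phiA.
have NC v w : v != w -> ~~ adj v w -> ~ commute (phi v) (phi w).
  by move=> /eqP vw /negP nvw C'; apply: nvw; apply/phiA.
have nac : a != c by apply: contraTneq cd => <-.
have nbd : b != d by apply: contraTneq ab => ->.
have nad : a != d by apply: contraTneq ab => ->; rewrite adj_sym.
by case: (P4_vert finG P4f (phiV a) (phiV b) (phiV c) (phiV d) (C _ _ ab) (C _ _ bc)
  (C _ _ cd)); apply: NC.
Qed.

Lemma realized_P3P1 : ~ has_P4 G -> has_P3P1 L -> has_P3P1 G.
Proof.
move=> P4f [a [b [c [d [[ab bc nac ac] da db dc]]]]]; apply: contrapT => P3P1f.
case: HR => [[f fI]|[phi [phiI phiV phiA]]].
  have /eqP := P3P1_law_witness ab bc nac ac da db dc; apply; apply: fI.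
  rewrite gmulf1 !gmulfR gmulfJ; apply: P3P1_law => //; exact: hom_commute.
have C v w : adj v w -> commute (phi v) (phi w) by case/phiA.
have NC v w : v != w -> ~~ adj v w -> ~ commute (phi v) (phi w).
  by move=> /eqP vw /negP nvw C'; apply: nvw; apply/phiA.
have nda : d != a by apply: contraNneq db => ->.
have ndb : d != b by apply: contraNneq da => ->; rewrite adj_sym.
have ndc : d != c by apply: contraNneq db => ->; rewrite adj_sym.
by case: (P3P1_vert finG P4f P3P1f (phiV a) (phiV b) (phiV c) (phiV d) (C _ _ ab)
  (C _ _ bc)) => [|[]]; apply: NC.
Qed.

Lemma realized_P3 : has_P3 L -> has_P3 G.
Proof.
move=> [a [b [c [ab bc nac ac]]]]; apply: contrapT => P3f.
have tr (x y z : raag G) : y != 1 -> commute x y -> commute y z -> commute x z.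
  apply: (commute_trans_P3 finG (s0 := xpredT)); rewrite ?in_subT //.
  move=> u v w _ _ _ uv vw uw.
  by apply: contrapT => /negP nuw; apply: P3f; exists u, v, w.
case: HR => [[f fI]|[phi [phiI phiV phiA]]].
  apply: (hom_noncommute fI nac ac); apply: (tr _ (f (raag_gen b)));
    [|exact: hom_commute..].
  by rewrite gmulf_eq1 // raag_gen_neq1.
have [_ C1] := (phiA a b).1 ab; have [_ C2] := (phiA b c).1 bc.
move/negP: ac; apply; apply/phiA; split; first exact/eqP.
exact: tr (vert_neq1 (phiV b)) C1 C2.
Qed.

Lemma realized_P2P1 : ~ has_P4 G -> has_P2P1 L -> has_P2P1 G.
Proof.
move=> P4f [a [b [d [ab da db]]]]; apply: contrapT => P2P1f.
case: HR => [[f fI]|[phi [phiI phiV phiA]]].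
  have [M M0 ME] := P2P1_law finG P4f P2P1f (hom_commute f ab).
  apply: (P2P1_law_witness ab da db M0); apply: fI; rewrite gmulf1.
  rewrite -[RHS](ME (f (raag_gen d))) /iter_comm.
  elim: M (raag_gen d) {M0 ME} => //= -[[e m] n] M IHM x; rewrite IHM gmulfR.
  congr (foldl _ [~ _, _] _); rewrite /combo gmulfM gmulfXn.
  by case: e; rewrite ?gmulfV gmulfXn.
have C v w : adj v w -> commute (phi v) (phi w) by case/phiA.
have NC v w : v != w -> ~~ adj v w -> ~ commute (phi v) (phi w).
  by move=> /eqP vw /negP nvw C'; apply: nvw; apply/phiA.
have nda : d != a by apply: contraNneq db => ->.
have ndb : d != b by apply: contraNneq da => ->; rewrite adj_sym.
case: (P2P1_vert finG P4f P2P1f (phiV a) (phiV b) (phiV d) (C _ _ ab)).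
- by move/phiI => E; rewrite E adj_irr in ab.
- exact: NC.
- exact: NC.
Qed.

Lemma realized_P2 : has_P2 L -> has_P2 G.
Proof.
move=> [a [b ab]]; apply: contrapT => P2f.
have edgeless (u v : G) : xpredT u -> xpredT v -> ~~ adj u v.
  by move=> _ _; apply/negP => uv; apply: P2f; exists u, v.
case: HR => [[f fI]|[phi [phiI phiV phiA]]].
  have [|m [n [m0 E]]] := edgeless_root finG edgeless (in_subT _) (in_subT _)
    (hom_commute f ab).
    by rewrite gmulf_eq1 // raag_gen_neq1.
  have [N1 N2] := raag_gen_pow_neq n (adj_neq ab) m0.
  by case: E => E; [apply: N1|apply: N2]; apply: fI; rewrite ?gmulfV !gmulfXn.
have [nab C] := (phiA a b).1 ab; apply: nab; apply: phiI.
exact: (edgeless_vert finG edgeless (phiV a) (phiV b) C).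
Qed.

Lemma realized_2P1 : has_2P1 L -> has_2P1 G.
Proof.
move=> [a [b [nab ab]]]; apply: contrapT => P1f.
have C (x y : raag G) : commute x y.
  apply: (@commute_sub G xpredT xpredT); rewrite ?in_subT // => u v _ _ uv.
  by apply: contrapT => /negP nuv; apply: P1f; exists u, v.
case: HR => [[f fI]|[phi [phiI phiV phiA]]].
  exact: (hom_noncommute fI nab ab).
by move/negP: ab; apply; apply/phiA; split; first exact/eqP.
Qed.

Lemma realized_P1 : L -> inhabited G.
Proof.
move=> v; apply: contrapT => nG.
case: HR => [[f fI]|[phi [phiI phiV phiA]]]; last first.
  by have [u _] := phiV v; apply: nG; exists.
have f1 : f (raag_gen v) = 1.
  by elim/raag_ind: (f _) => // u; case: nG; exists.
by have := raag_gen_neq1 v; rewrite -(gmulf_eq1 _ fI) f1 eqxx.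
Qed.

(** The graphs P4, P3 + P1, P3, P2 + P1, P2, 2 P1 are tried in this order. The first one found in
    [L] is forced on [G], and the absence of the earlier ones limits [L] to what that graph can
    produce. *)
Lemma realized_strong_emb : finite_graph L -> acyclic_graph L -> strong_emb L G.
Proof.
move=> finL acL.
have [P4G|P4G] := pselect (has_P4 G); first exact: strong_emb_P4.
have P4L : ~ has_P4 L by move/realized_P4.
have [e eE] : exists e : seq L, forall v, v \in e.
  have /finite_seqP[e eE] := finL; exists e => v.
  by have : [set: L]%classic v by []; rewrite eE.
pose idx (v : L) := index v e.
have idxI : injective idx.
  by move=> v w; rewrite /idx => E; rewrite -(nth_index v (eE v)) E nth_index.
have [r [rK rE]] := star_forest_root idxI acL P4L.
have [/(realized_P3P1 P4G)|P3P1L] := pselect (has_P3P1 L).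
  exact: (star_forest_P3P1 idxI rE).
have [P3L|P3L] := pselect (has_P3 L).
  exact: (star_forest_P3 idxI rE P3L P3P1L (realized_P3 P3L)).
have [/(realized_P2P1 P4G)|P2P1L] := pselect (has_P2P1 L).
  exact: (star_forest_P2P1 idxI rK rE P3L).
have [P2L|P2L] := pselect (has_P2 L).
  have [u [v uv]] := realized_P2 P2L; have [a [b ab]] := P2L.
  (* A third vertex would create [P3] or [P2 + P1]. *)
  have L2 w : w = a \/ w = b.
    apply: contrapT => /not_orP[/eqP wa /eqP wb].
    have [aw|aw] := boolP (adj a w).
      apply: P3L; exists b, a, w; split=> //; rewrite 1?adj_sym 1?eq_sym //.
      by apply: (@acyclic_triangle _ w a b) => //; rewrite adj_sym.
    have [bw|bw] := boolP (adj b w).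
      by apply: P3L; exists a, b, w; split=> //; rewrite eq_sym.
    by apply: P2P1L; exists a, b, w; split=> //; rewrite adj_sym.
  have nba : (b == a) = false by apply: contraTF ab => /eqP->; rewrite adj_irr.
  have nuv : u != v by apply: contraTneq uv => ->; rewrite adj_irr.
  apply: (@strong_emb_induced _ _ (fun w => if w == a then u else v)).
    move=> x y; case: (L2 x) => ->; case: (L2 y) => ->; rewrite ?eqxx ?nba // => E;
    by rewrite E eqxx in nuv.
  move=> x y; case: (L2 x) => ->; case: (L2 y) => ->;
  by rewrite ?eqxx ?nba ?adj_irr ?[adj b a]adj_sym ?[adj v u]adj_sym ?ab.
have [/realized_2P1|P1L] := pselect (has_2P1 L).
  exact: edgeless_emb idxI P2L.
have L1 (x y : L) : x = y.
  apply/eqP/negPn/negP => xy; apply: P1L; exists x, y; split=> //.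
  by apply/negP => E; apply: P2L; exists x, y.
have [[v]|nL] := pselect (inhabited L).
  have [u] := realized_P1 v.
  apply: (@strong_emb_induced _ _ (fun=> u)) => x y; first by move=> _; apply: L1.
  by rewrite (L1 x y) !adj_irr.
have h (x : L) : G by case: nL; exists.
by apply: (@strong_emb_induced _ _ h) => x; case: nL; exists.
Qed.

End Main.

Theorem corollary8 (L G : graph) :
  finite_graph L -> finite_graph G -> forest L ->
  (embeds (raag L) (raag G) <->
   exists A : pred (ext_graph G), graph_iso L (induced A)).
Proof.
move=> finL finG /forest_acyclic acL; split=> [emb|ext].
  by apply/strong_emb_ext/realized_strong_emb => //; left.
have [f [fI _]] := realized_strong_emb finG (ext_realized ext) finL acL.
by exists f.
Qed.
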